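(* Let $k$ be an algebraically closed field of characteristic $0$ and let $n\ge1$. The virtual class in $K_0(\mathrm{Var}_k)$ of the variety $C_n(\mathrm{GL}_2(k))=\{(A_1,\dots,A_n)\in\mathrm{GL}_2(k)^n\mid A_iA_j=A_jA_i\text{ for all }i,j\}$ of commuting $n$-tuples of elements in $\mathrm{GL}_2(k)$ is given by $$vA^{n-1}w^T,$$ where $w=(q-1,\ (q-1)(q^2-1),\ (q-1)^2,\ 1-q)$, $v=(1,1,q^2,q)$ and $$A=\left(\begin{array}{cccc}q-1 & 0 & 0 &0\\ (q-1)(q^2-1) & q(q-1) & 0 & 0\\ (q-1)^2 & 0 & q(q-1) & 1-q\\ 1-q & 0 & 1-q & q(q-1)\end{array}\right).$$
   Context: $K_0(\mathrm{Var}_k)$ is the Grothendieck ring of varieties over $k$: the free abelian group on isomorphism classes of varieties modulo $[X]=[U]+[Z]$ for $Z\subseteq X$ closed with open complement $U$, with product induced by the fiber product over $k$. The virtual class of a variety $X$ is $[X]$, and $q=[\mathbb{A}^1]$. *)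

(* Defs.v *)
From HB Require Import structures.
From mathcomp Require Import all_boot all_order all_algebra.
From mathcomp Require Import boolp classical_sets functions topology.
From mathcomp Require Import -(notations) monalg.
From mathcomp Require Import -(notations) mpoly.

Set Implicit Arguments.
Unset Strict Implicit.
Unset Printing Implicit Defensive.

Import Order.TTheory GRing.Theory.
Local Open Scope classical_set_scope.
Local Open Scope ring_scope.

(* Varieties over the algebraically closed field [k] are taken in the classical
   sense (Serre's FAC; equivalently, reduced separated schemes of finite type
   over [k]): a topological space of points with a sheaf of [k]-valued functions
   that is locally isomorphic to a Zariski closed subset of an affine space.

   The sheaf of functions is given by its germs: [regular_at x f] says that the
   germ of [f] at [x] is a section, and the sections over an open [U] are the
   [f] that are regular at every point of [U]. Since [f] is a total function,
   only its values near [x] matter ([regular_at_near]). *)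
Record space (k : closedFieldType) := Space {
  points :> topologicalType;
  regular_at : points -> (points -> k) -> Prop;
  regular_at_near : forall x f g,
    (\near x, f x = g x) -> regular_at x f -> regular_at x g;
  regular_at_open : forall x f,
    regular_at x f -> \forall y \near x, regular_at y f;
  regular_at_cst : forall x c, regular_at x (fun=> c);
  regular_atD : forall x f g,
    regular_at x f -> regular_at x g -> regular_at x (fun y => f y + g y);
  regular_atM : forall x f g,
    regular_at x f -> regular_at x g -> regular_at x (fun y => f y * g y);
  regular_at_neq0 : forall x f,
    regular_at x f -> f x != 0 -> \forall y \near x, f y != 0;
  regular_atV : forall x f,
    regular_at x f -> f x != 0 -> regular_at x (fun y => (f y)^-1)
}.

Lemma near_all (T : topologicalType) (x : T) (P : set T) :
  (forall y, P y) -> \near x, P x.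
Proof. by move=> hP; apply: filterS filterT => y _. Qed.

Section Morphisms.
Variable k : closedFieldType.
Implicit Types X Y Z : space k.

Definition morphism X Y (f : X -> Y) : Prop :=
  continuous f /\ forall x g, regular_at (f x) g -> regular_at x (g \o f).

Definition isomorphic X Y : Prop :=
  exists (f : X -> Y) (g : Y -> X),
    [/\ morphism f, morphism g, cancel f g & cancel g f].

Lemma morphism_id X : morphism (@id X).
Proof. by split=> // x; exact: cvg_id. Qed.

Lemma morphism_comp X Y Z (f : X -> Y) (g : Y -> Z) :
  morphism f -> morphism g -> morphism (g \o f).
Proof.
move=> [cf rf] [cg rg]; split=> [x|x h hr].
  by apply: continuous_comp; [exact: cf|exact: cg].
exact/(rf _ (h \o g))/rg.
Qed.

Lemma isomorphic_refl X : isomorphic X X.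
Proof. by exists id, id; split=> //; exact: morphism_id. Qed.

Lemma isomorphic_sym X Y : isomorphic X Y -> isomorphic Y X.
Proof. by move=> [f [g [? ? ? ?]]]; exists g, f. Qed.

Lemma isomorphic_trans X Y Z :
  isomorphic X Y -> isomorphic Y Z -> isomorphic X Z.
Proof.
move=> [f [g [mf mg fg gf]]] [f' [g' [mf' mg' fg' gf']]].
exists (f' \o f), (g \o g'); split; [exact: morphism_comp..| |];
  exact: can_comp.
Qed.

Lemma regular_at_eq X (x : X) f g :
  f =1 g -> regular_at x f -> regular_at x g.
Proof. by move=> /funext ->. Qed.

Lemma regular_atN X (x : X) f : regular_at x f -> regular_at x (fun y => - f y).
Proof.
move=> hf; have := regular_atM (regular_at_cst x (-1)) hf.
by apply: regular_at_eq => y; rewrite mulN1r.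
Qed.

Lemma regular_atB X (x : X) f g : regular_at x f -> regular_at x g ->
  regular_at x (fun y => f y - g y).
Proof. by move=> hf hg; apply: regular_atD => //; exact: regular_atN. Qed.

Lemma regular_at_sum X (x : X) (I : Type) (r : seq I) (P : pred I)
    (F : I -> X -> k) : (forall i, P i -> regular_at x (F i)) ->
  regular_at x (fun y => \sum_(i <- r | P i) F i y).
Proof.
move=> hF; elim: r => [|i r IHr].
  by apply: regular_at_eq (regular_at_cst x _) => y; rewrite big_nil.
case Pi: (P i); last by apply: regular_at_eq IHr => y; rewrite big_cons Pi.
apply: regular_at_eq (regular_atD (hF _ Pi) IHr) => y.
by rewrite big_cons Pi.
Qed.

Lemma regular_at_prod X (x : X) (I : Type) (r : seq I) (P : pred I)
    (F : I -> X -> k) : (forall i, P i -> regular_at x (F i)) ->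
  regular_at x (fun y => \prod_(i <- r | P i) F i y).
Proof.
move=> hF; elim: r => [|i r IHr].
  by apply: regular_at_eq (regular_at_cst x _) => y; rewrite big_nil.
case Pi: (P i); last by apply: regular_at_eq IHr => y; rewrite big_cons Pi.
apply: regular_at_eq (regular_atM (hF _ Pi) IHr) => y.
by rewrite big_cons Pi.
Qed.

Lemma regular_atX X (x : X) f n :
  regular_at x f -> regular_at x (fun y => f y ^+ n).
Proof.
move=> hf; elim: n => [|n IHn].
  by apply: regular_at_eq (regular_at_cst x _) => y; rewrite expr0.
by apply: regular_at_eq (regular_atM hf IHn) => y; rewrite exprS.
Qed.

Lemma open_neq0 X (f : X -> k) : (forall x, regular_at x f) ->
  open [set x | f x != 0].
Proof. by move=> hf; rewrite openE => x fx; exact: regular_at_neq0. Qed.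

Lemma closed_eq0 X (f : X -> k) : (forall x, regular_at x f) ->
  closed [set x | f x = 0].
Proof.
move=> hf; rewrite -[X in closed X]setCK; apply: open_closedC.
rewrite (_ : ~` _ = [set x | f x != 0]); first exact: open_neq0.
by apply/seteqP; split=> x /eqP.
Qed.

Lemma closed_preimage X Y (f : X -> Y) (A : set Y) :
  morphism f -> closed A -> closed (f @^-1` A).
Proof. by move=> [cf _]; apply: closed_comp => x _; exact: cf. Qed.

Lemma open_preimage X Y (f : X -> Y) (A : set Y) :
  morphism f -> open A -> open (f @^-1` A).
Proof. by move=> [cf _]; apply: open_comp => x _; exact: cf. Qed.

End Morphisms.

Section Subspace.
Variables (k : closedFieldType) (X : space k) (S : set X).

Definition sub_regular_at (x : S) (f : S -> k) : Prop :=
  exists2 F : X -> k, regular_at (val x) F & \near x, f x = F (val x).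

Lemma continuous_val : continuous (val : S -> X).
Proof. by rewrite -set_valE; exact: initial_continuous. Qed.

Let near_val (x : S) (A : set X) :
  nbhs (val x) A -> \forall y \near x, A (val y).
Proof. by move=> h; exact: continuous_val. Qed.

Lemma sub_regular_at_near x f g :
  (\near x, f x = g x) -> sub_regular_at x f -> sub_regular_at x g.
Proof.
move=> fg [F rF fF]; exists F => //.
by apply: filterS2 fg fF => y <-.
Qed.

Lemma sub_regular_at_open x f :
  sub_regular_at x f -> \forall y \near x, sub_regular_at y f.
Proof.
move=> [F /regular_at_open/near_val rF /near_join fF].
by apply: filterS2 rF fF => y rF fF; exists F.
Qed.

Lemma sub_regular_at_cst x c : sub_regular_at x (fun=> c).
Proof. by exists (fun=> c); [exact: regular_at_cst|exact: near_all]. Qed.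

Lemma sub_regular_atD x f g : sub_regular_at x f -> sub_regular_at x g ->
  sub_regular_at x (fun y => f y + g y).
Proof.
move=> [F rF fF] [G rG gG]; exists (fun y => F y + G y).
  exact: regular_atD.
by apply: filterS2 fF gG => y -> ->.
Qed.

Lemma sub_regular_atM x f g : sub_regular_at x f -> sub_regular_at x g ->
  sub_regular_at x (fun y => f y * g y).
Proof.
move=> [F rF fF] [G rG gG]; exists (fun y => F y * G y).
  exact: regular_atM.
by apply: filterS2 fF gG => y -> ->.
Qed.

Lemma sub_regular_at_neq0 x f : sub_regular_at x f -> f x != 0 ->
  \forall y \near x, f y != 0.
Proof.
move=> [F rF fF]; rewrite (nbhs_singleton fF) => /(regular_at_neq0 rF)/near_val.
by apply: filterS2 fF => y ->.
Qed.

Lemma sub_regular_atV x f : sub_regular_at x f -> f x != 0 ->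
  sub_regular_at x (fun y => (f y)^-1).
Proof.
move=> [F rF fF]; rewrite (nbhs_singleton fF) => Fx.
exists (fun y => (F y)^-1); first exact: regular_atV.
by apply: filterS fF => y ->.
Qed.

Definition subspace : space k := Space sub_regular_at_near sub_regular_at_open
  sub_regular_at_cst sub_regular_atD sub_regular_atM sub_regular_at_neq0
  sub_regular_atV.

Lemma morphism_val : morphism (val : subspace -> X).
Proof.
split=> [|x g rg]; first exact: continuous_val.
by exists g => //; exact: near_all.
Qed.

Lemma morphism_to_sub (Y : space k) (f : Y -> subspace) :
  morphism (val \o f : Y -> X) -> morphism f.
Proof.
move=> [cf rf]; have cf' : continuous f.
  move=> y A; rewrite nbhsE => -[B [[B' oB' <-] B'y] BA].
  have : nbhs y ((val \o f) @^-1` B') by apply: cf; exact: open_nbhs_nbhs.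
  by apply: filterS => z B'z; exact: BA.
split=> // y g [G rG gG].
apply: regular_at_near (rf _ _ rG); near=> z.
by rewrite /=; apply/esym; near: z; exact: cf' gG.
Unshelve. all: by end_near. Qed.

Definition to_sub (Y : space k) (f : Y -> X) (h : forall y, S (f y)) (y : Y) :
  subspace := exist _ (f y) (mem_set (h y)).

Lemma morphism_sub (Y : space k) (f : Y -> X) (h : forall y, S (f y)) :
  morphism f -> morphism (to_sub h).
Proof. by move=> mf; exact: morphism_to_sub. Qed.

End Subspace.

Lemma isomorphic_setT (k : closedFieldType) (X : space k) :
  isomorphic (subspace [set: X]) X.
Proof.
exists val, (@to_sub _ _ setT X id (fun=> I)); split.
- exact: morphism_val.
- by apply: morphism_sub; exact: morphism_id.
- by move=> x; exact: val_inj.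
- by [].
Qed.

Lemma isomorphic_preimage (k : closedFieldType) (X Y : space k)
    (f : X -> Y) (g : Y -> X) (S : set Y) :
  morphism f -> morphism g -> cancel f g -> cancel g f ->
  isomorphic (subspace (f @^-1` S)) (subspace S).
Proof.
move=> mf mg fK gK.
have hf (x : subspace (f @^-1` S)) : S ((f \o val) x).
  exact: (@set_valP _ (f @^-1` S) x).
have hg (y : subspace S) : (f @^-1` S) ((g \o val) y).
  by rewrite /= gK; exact: (@set_valP _ S y).
exists (to_sub hf), (to_sub hg); split.
- by apply: morphism_sub; apply: morphism_comp => //; exact: morphism_val.
- by apply: morphism_sub; apply: morphism_comp => //; exact: morphism_val.
- by move=> x; apply: val_inj; rewrite /= fK.
- by move=> x; apply: val_inj; rewrite /= gK.
Qed.

Section Product.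
Variables (k : closedFieldType) (X Y : space k).

(* The product in the category of spaces with functions. [zprod] carries the
   topology generated by the sets {q in U * V | h q != 0}, with U, V open and
   h = sum_i f_i (x) g_i regular on U * V. It is finer than the product topology
   that [X * Y] carries in the library, to which [\near] refers whenever the
   point has type [X * Y]; [prod_regular_at] uses the topology of [zprod]. *)
Definition zprod : Type := (X * Y)%type.
HB.instance Definition _ := Choice.on zprod.

Definition tensor_at (p : X * Y) (h : X * Y -> k) : Prop :=
  exists (I : finType) (f : I -> X -> k) (g : I -> Y -> k),
    [/\ forall i, regular_at p.1 (f i), forall i, regular_at p.2 (g i)
      & h = fun q => \sum_i f i q.1 * g i q.2].

Lemma tensor_at_cst p c : tensor_at p (fun=> c).
Proof.
exists unit, (fun _ _ => c), (fun _ _ => 1); split=> [_|_|].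
- exact: regular_at_cst.
- exact: regular_at_cst.
- by apply/funext => q; rewrite big_const card_unit /= mulr1 addr0.
Qed.

Lemma tensor_at_fst (p : X * Y) f :
  regular_at p.1 f -> tensor_at p (fun q => f q.1).
Proof.
move=> hf; exists unit, (fun _ => f), (fun _ _ => 1); split=> [//|_|].
- exact: regular_at_cst.
- by apply/funext => q; rewrite big_const card_unit /= mulr1 addr0.
Qed.

Lemma tensor_at_snd (p : X * Y) f :
  regular_at p.2 f -> tensor_at p (fun q => f q.2).
Proof.
move=> hf; exists unit, (fun _ _ => 1), (fun _ => f); split=> [_|//|].
- exact: regular_at_cst.
- by apply/funext => q; rewrite big_const card_unit /= mul1r addr0.
Qed.

Lemma tensor_atD p h1 h2 : tensor_at p h1 -> tensor_at p h2 ->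
  tensor_at p (fun q => h1 q + h2 q).
Proof.
move=> [I [f [g [hf hg ->]]]] [J [f' [g' [hf' hg' ->]]]].
exists (I + J)%type,
  (fun s => match s with inl i => f i | inr j => f' j end),
  (fun s => match s with inl i => g i | inr j => g' j end).
split; [by case|by case|].
by apply/funext => q; rewrite big_sumType.
Qed.

Lemma tensor_atM p h1 h2 : tensor_at p h1 -> tensor_at p h2 ->
  tensor_at p (fun q => h1 q * h2 q).
Proof.
move=> [I [f [g [hf hg ->]]]] [J [f' [g' [hf' hg' ->]]]].
exists (I * J)%type, (fun s x => f s.1 x * f' s.2 x),
  (fun s y => g s.1 y * g' s.2 y); split=> [s|s|].
- exact: regular_atM.
- exact: regular_atM.
apply/funext => q; rewrite big_distrlr /= pair_big /=.
by apply: eq_bigr => s _; rewrite mulrACA.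
Qed.

Lemma tensor_at_open (p : X * Y) h :
  tensor_at p h -> \forall q \near p, tensor_at q h.
Proof.
move=> [I [f [g [hf hg ->]]]].
have nf : \forall x \near p.1, forall i, regular_at x (f i).
  by apply: filter_forall => i; exact: regular_at_open.
have ng : \forall y \near p.2, forall i, regular_at y (g i).
  by apply: filter_forall => i; exact: regular_at_open.
exists ([set x | forall i, regular_at x (f i)],
        [set y | forall i, regular_at y (g i)]) => //= q [qf qg].
by exists I, f, g.
Qed.

Definition prod_open (O : set (X * Y)) : Prop := forall p, O p ->
  exists h, [/\ tensor_at p h, h p != 0 &
                \forall q \near p, h q != 0 -> O q].

Lemma prod_openT : prod_open setT.
Proof.
move=> p _; exists (fun=> 1); split; first exact: tensor_at_cst.
  exact: oner_neq0.
exact: near_all.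
Qed.

Lemma prod_openI : setI_closed prod_open.
Proof.
move=> A B oA oB p [/oA[h [th hp hA]] /oB[h' [th' hp' hB]]].
exists (fun q => h q * h' q); split; first exact: tensor_atM.
  exact: mulf_neq0.
apply: filterS2 hA hB => q hA hB; rewrite mulf_eq0 negb_or => /andP[hq hq'].
by split; [exact: hA|exact: hB].
Qed.

Lemma prod_open_bigU (I : Type) (A : I -> set (X * Y)) :
  (forall i, prod_open (A i)) -> prod_open (\bigcup_i A i).
Proof.
move=> oA p [i _ /oA[h [th hp hA]]]; exists h; split=> //.
by apply: filterS hA => q hA /hA; exists i.
Qed.

HB.instance Definition _ :=
  isOpenTopological.Build zprod prod_openT prod_openI prod_open_bigU.

Lemma zprod_nbhsP (p : zprod) (A : set zprod) :
  nbhs p A <-> exists h, [/\ tensor_at p h, h p != 0 &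
    nbhs (p : (X * Y)%type) [set q | h q != 0 -> A q]].
Proof.
split=> [|[h [th hp hA]]].
  rewrite nbhsE => -[B [oB Bp] BA]; have [h [th hp hB]] := oB _ Bp.
  by exists h; split=> //; apply: filterS hB => q hB /hB/BA.
pose N := [set q : zprod | exists h, [/\ tensor_at q h, h q != 0 &
    nbhs (q : (X * Y)%type) [set q | h q != 0 -> A q]]].
rewrite nbhsE; exists N; last first.
  by move=> q [h' [_ hq /nbhs_singleton]]; exact.
split; last by exists h.
move=> q [h' [/tensor_at_open th' hq /near_join hA']].
exists h'; split=> //; first exact: nbhs_singleton th'.
by apply: filterS2 th' hA' => r tr hr hr0; exists h'.
Qed.

Lemma nbhs_zprod (p : X * Y) (A : set (X * Y)) :
  nbhs p A -> nbhs (p : zprod) A.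
Proof.
move=> pA; apply/zprod_nbhsP; exists (fun=> 1); split.
- exact: tensor_at_cst.
- exact: oner_neq0.
- by apply: filterS pA => q Aq _.
Qed.

Lemma tensor_at_neq0 (p : zprod) h :
  tensor_at p h -> h p != 0 -> \forall q \near p, h q != 0.
Proof.
by move=> th hp; apply/zprod_nbhsP; exists h; split=> //; apply: (@near_all (X * Y)%type) => q.
Qed.

Definition prod_regular_at (p : zprod) (F : zprod -> k) : Prop :=
  exists a b, [/\ tensor_at p a, tensor_at p b, b p != 0 &
                  \forall q \near p, F q = a q / b q].

Lemma tensor_at_regular (p : zprod) h : tensor_at p h -> prod_regular_at p h.
Proof.
move=> th; exists h, (fun=> 1); split=> //; first exact: tensor_at_cst.
  exact: oner_neq0.
by apply: near_all => q; rewrite divr1.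
Qed.

Lemma prod_regular_at_near p f g :
  (\near p, f p = g p) -> prod_regular_at p f -> prod_regular_at p g.
Proof.
move=> fg [a [b [ta tb bp fE]]]; exists a, b; split=> //.
by apply: filterS2 fg fE => q <-.
Qed.

Lemma prod_regular_at_open p f :
  prod_regular_at p f -> \forall q \near p, prod_regular_at q f.
Proof.
move=> [a [b [ta tb bp /near_join fE]]].
near=> q; exists a, b; split; near: q => //.
- exact/nbhs_zprod/tensor_at_open.
- exact/nbhs_zprod/tensor_at_open.
- exact: tensor_at_neq0.
Unshelve. all: by end_near. Qed.

Lemma prod_regular_at_cst p c : prod_regular_at p (fun=> c).
Proof. exact/tensor_at_regular/tensor_at_cst. Qed.

Lemma prod_regular_atD p f g : prod_regular_at p f -> prod_regular_at p g ->
  prod_regular_at p (fun q => f q + g q).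
Proof.
move=> [a [b [ta tb bp fE]]] [c [d [tc td dp gE]]].
exists (fun q => a q * d q + c q * b q), (fun q => b q * d q); split.
- by apply: tensor_atD; exact: tensor_atM.
- exact: tensor_atM.
- exact: mulf_neq0.
near=> q; rewrite (near fE q) // (near gE q) // addf_div //.
- by near: q; exact: tensor_at_neq0.
- by near: q; exact: tensor_at_neq0.
Unshelve. all: by end_near. Qed.

Lemma prod_regular_atM p f g : prod_regular_at p f -> prod_regular_at p g ->
  prod_regular_at p (fun q => f q * g q).
Proof.
move=> [a [b [ta tb bp fE]]] [c [d [tc td dp gE]]].
exists (fun q => a q * c q), (fun q => b q * d q); split.
- exact: tensor_atM.
- exact: tensor_atM.
- exact: mulf_neq0.
by apply: filterS2 fE gE => q -> ->; rewrite mulf_div.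
Qed.

Lemma prod_regular_at_neq0 p f : prod_regular_at p f -> f p != 0 ->
  \forall q \near p, f q != 0.
Proof.
move=> [a [b [ta tb bp fE]]]; rewrite (nbhs_singleton fE) => ap.
have ap0 : a p != 0 by apply: contraNneq ap => ->; rewrite mul0r.
apply: filterS3 fE (tensor_at_neq0 ta ap0) (tensor_at_neq0 tb bp).
by move=> q -> aq bq; rewrite mulf_neq0 ?invr_eq0.
Qed.

Lemma prod_regular_atV p f : prod_regular_at p f -> f p != 0 ->
  prod_regular_at p (fun q => (f q)^-1).
Proof.
move=> [a [b [ta tb bp fE]]]; rewrite (nbhs_singleton fE) => ap.
have ap0 : a p != 0 by apply: contraNneq ap => ->; rewrite mul0r.
exists b, a; split=> //.
by apply: filterS fE => q ->; rewrite invf_div.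
Qed.

Definition product : space k := Space prod_regular_at_near prod_regular_at_open
  prod_regular_at_cst prod_regular_atD prod_regular_atM prod_regular_at_neq0
  prod_regular_atV.

Lemma morphism_fst : morphism (fst : product -> X).
Proof.
split=> [p A pA|p g rg].
  apply: nbhs_zprod; exact: (@cvg_fst _ _ (nbhs p.1) (nbhs p.2)).
exact/tensor_at_regular/(tensor_at_fst rg).
Qed.

Lemma morphism_snd : morphism (snd : product -> Y).
Proof.
split=> [p A pA|p g rg].
  apply: nbhs_zprod; exact: (@cvg_snd _ _ (nbhs p.1) (nbhs p.2)).
exact/tensor_at_regular/(tensor_at_snd rg).
Qed.

Lemma morphism_pair (Z : space k) (f : Z -> X) (g : Z -> Y) :
  morphism f -> morphism g -> morphism (fun z => (f z, g z) : product).
Proof.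
move=> [cf rf] [cg rg].
have rt z h : tensor_at (f z, g z) h -> regular_at z (fun z => h (f z, g z)).
  move=> [I [u [v [ru rv ->]]]] /=; apply: regular_at_sum => i _.
  by apply: regular_atM; [exact: (rf _ _ (ru i))|exact: (rg _ _ (rv i))].
have cfg : continuous (fun z => (f z, g z) : product).
  move=> z A /zprod_nbhsP[h [th hz hA]].
  have hA' : \forall z \near z, h (f z, g z) != 0 -> A (f z, g z).
    exact: (cvg_pair (cf z) (cg z) hA).
  by apply: filterS2 hA' (regular_at_neq0 (rt _ _ th) hz) => t; exact.
split=> // z F [a [b [ta tb bz FE]]].
have := regular_atM (rt _ _ ta) (regular_atV (rt _ _ tb) bz).
apply: regular_at_near.
have FE' : \forall t \near z, F (f t, g t) = a (f t, g t) / b (f t, g t).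
  exact: (cfg z _ FE).
by apply: filterS FE' => t /= ->.
Qed.

End Product.

Section ProductTheory.
Variable k : closedFieldType.
Implicit Types X Y Z : space k.

Lemma morphism_prod X X' Y Y' (f : X -> X') (g : Y -> Y') :
  morphism f -> morphism g ->
  morphism (fun p : product X Y => (f p.1, g p.2) : product X' Y').
Proof.
move=> mf mg; apply: (@morphism_pair _ _ _ (product X Y) (f \o fst) (g \o snd)).
- by apply: morphism_comp mf; exact: morphism_fst.
- by apply: morphism_comp mg; exact: morphism_snd.
Qed.

Lemma isomorphic_product X X' Y Y' : isomorphic X X' -> isomorphic Y Y' ->
  isomorphic (product X Y) (product X' Y').
Proof.
move=> [f [f' [mf mf' fK f'K]]] [g [g' [mg mg' gK g'K]]].
exists (fun p => (f p.1, g p.2)), (fun p => (f' p.1, g' p.2)); split.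
- exact: morphism_prod.
- exact: morphism_prod.
- by case=> x y /=; rewrite fK gK.
- by case=> x y /=; rewrite f'K g'K.
Qed.

Lemma isomorphic_productC X Y : isomorphic (product X Y) (product Y X).
Proof.
have sw A B : morphism (fun p : product A B => (p.2, p.1) : product B A).
  by apply: morphism_pair; [exact: morphism_snd|exact: morphism_fst].
exists (fun p => (p.2, p.1)), (fun p => (p.2, p.1)); split=> //.
- by case.
- by case.
Qed.

Lemma isomorphic_productA X Y Z :
  isomorphic (product X (product Y Z)) (product (product X Y) Z).
Proof.
pose P := product X (product Y Z); pose Q := product (product X Y) Z.
exists (fun p => ((p.1, p.2.1), p.2.2)), (fun p => (p.1.1, (p.1.2, p.2))).
split; last 2 first.
- by case=> x [].
- by case=> [[]].
- apply: (@morphism_pair k (product X Y) Z P (fun p => (p.1, p.2.1)) (snd \o snd)).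
    apply: (@morphism_pair k X Y P fst (fst \o snd)).
      exact: morphism_fst.
    exact: (morphism_comp (@morphism_snd k X _) (@morphism_fst k Y Z)).
  exact: (morphism_comp (@morphism_snd k X _) (@morphism_snd k Y Z)).
- apply: (@morphism_pair k X (product Y Z) Q (fst \o fst) (fun p => (p.1.2, p.2))).
    exact: (morphism_comp (@morphism_fst k _ Z) (@morphism_fst k X Y)).
  apply: (@morphism_pair k Y Z Q (snd \o fst) snd).
    exact: (morphism_comp (@morphism_fst k _ Z) (@morphism_snd k X Y)).
  exact: morphism_snd.
Qed.

Lemma isomorphic_subproduct X Y (S : set X) (T : set Y) :
  isomorphic (subspace ((S `*` T) : set (product X Y)))
             (product (subspace S) (subspace T)).
Proof.
set P := subspace _.
have h1 (p : P) : S ((fst \o val) p) by have [] := @set_valP _ (S `*` T) p.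
have h2 (p : P) : T ((snd \o val) p) by have [] := @set_valP _ (S `*` T) p.
have h (q : product (subspace S) (subspace T)) :
    (S `*` T) (val q.1, val q.2).
  by split; [exact: (@set_valP _ S q.1)|exact: (@set_valP _ T q.2)].
exists (fun p => (to_sub h1 p, to_sub h2 p)), (to_sub (X := product X Y) h).
split.
- apply: morphism_pair.
    apply/morphism_to_sub/(morphism_comp (@morphism_val _ _ _)).
    exact: morphism_fst.
  apply/morphism_to_sub/(morphism_comp (@morphism_val _ _ _)).
  exact: morphism_snd.
- by apply/morphism_to_sub; apply: morphism_prod; exact: morphism_val.
- by case=> [[x y] ?]; exact: val_inj.
- by case=> x y; congr pair; exact: val_inj.
Qed.

End ProductTheory.

Section Affine.
Variables (k : closedFieldType) (V : vectType k).

(* [V] as an affine space: polynomial functions on [V] are polynomials in the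
   coordinates in some basis of [V], and do not depend on that basis. The alias
   [zariski] carries the Zariski topology. *)
Definition zariski : Type := V.
HB.instance Definition _ := Choice.on zariski.

Local Notation poly := (mpoly (\dim {:V}) k).

Definition peval (p : poly) (v : V) : k :=
  meval (fun i => coord (vbasis {:V}) i v) p.

Definition zariski_open (U : set zariski) : Prop :=
  exists P : set poly, ~` U = [set v | forall p, P p -> peval p v = 0].

Lemma zariski_openT : zariski_open setT.
Proof.
exists [set 1]; rewrite setCT; apply/seteqP; split=> // v /(_ _ erefl) /eqP.
by rewrite /peval meval1 oner_eq0.
Qed.

Lemma zariski_openI : setI_closed zariski_open.
Proof.
move=> A B [P AP] [Q BQ]; exists [set r | exists p q, [/\ P p, Q q & r = p * q]].
rewrite setCI AP BQ; apply/seteqP; split=> v /=.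
  by case=> h r [p [q [Pp Qq ->]]]; rewrite /peval mevalM;
    [rewrite [X in X * _]h ?mul0r|rewrite [X in _ * X]h ?mulr0].
move=> h; apply: contrapT => /not_orP[/existsNP[p /not_implyP[Pp /eqP pv]]].
move=> /existsNP[q /not_implyP[Qq /eqP qv]].
have /eqP := h _ (ex_intro _ p (ex_intro _ q (And3 Pp Qq erefl))).
by rewrite /peval mevalM mulf_eq0 (negPf pv) (negPf qv).
Qed.

Lemma zariski_open_bigU (I : Type) (A : I -> set zariski) :
  (forall i, zariski_open (A i)) -> zariski_open (\bigcup_i A i).
Proof.
move=> oA; exists [set p | forall v, ~ (\bigcup_i A i) v -> peval p v = 0].
apply/seteqP; split=> [v Av p /(_ _ Av)//|v h [i _ Aiv]].
have [P AP] := oA i; suff : (~` A i) v by exact.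
rewrite AP => p Pp; apply: h => w Aw.
suff : (~` A i) w by rewrite AP; exact.
by move=> Aiw; apply: Aw; exists i.
Qed.

HB.instance Definition _ := isOpenTopological.Build zariski
  zariski_openT zariski_openI zariski_open_bigU.

Definition affine_regular_at (v : zariski) (f : zariski -> k) : Prop :=
  exists a b : poly,
    peval b v != 0 /\ \forall w \near v, f w = peval a w / peval b w.

Lemma peval_near_neq0 (v : zariski) (p : poly) :
  peval p v != 0 -> \forall w \near v, peval p w != 0.
Proof.
move=> pv; apply: open_nbhs_nbhs; split=> //.
exists [set p]; apply/seteqP; split=> w /=.
  by move=> /negP; rewrite negbK => /eqP pw _ ->.
by move=> /(_ _ erefl) ->; rewrite eqxx.
Qed.

Lemma affine_regular_at_near v f g :
  (\near v, f v = g v) -> affine_regular_at v f -> affine_regular_at v g.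
Proof.
move=> fg [a [b [bv fE]]]; exists a, b; split=> //.
by apply: filterS2 fg fE => q <-.
Qed.

Lemma affine_regular_at_open v f :
  affine_regular_at v f -> \forall w \near v, affine_regular_at w f.
Proof.
move=> [a [b [/peval_near_neq0 bv /near_join fE]]].
by apply: filterS2 bv fE => w bw fE; exists a, b.
Qed.

Lemma peval_regular v (p : poly) : affine_regular_at v (peval p).
Proof.
exists p, 1; split; first by rewrite /peval meval1 oner_neq0.
by apply: near_all => w; rewrite [in RHS]/peval meval1 divr1.
Qed.

Lemma affine_regular_at_cst v c : affine_regular_at v (fun=> c).
Proof.
apply: affine_regular_at_near (peval_regular v (mpolyC _ c)).
by apply: near_all => w; rewrite /peval mevalC.
Qed.

Lemma affine_regular_atD v f g : affine_regular_at v f ->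
  affine_regular_at v g -> affine_regular_at v (fun w => f w + g w).
Proof.
move=> [a [b [bv fE]]] [c [d [dv gE]]].
exists (a * d + c * b), (b * d); split.
  by rewrite /peval mevalM mulf_neq0.
near=> w; rewrite (near fE w) // (near gE w) // addf_div.
- by rewrite /peval mevalD !mevalM.
- by near: w; exact: peval_near_neq0.
- by near: w; exact: peval_near_neq0.
Unshelve. all: by end_near. Qed.

Lemma affine_regular_atM v f g : affine_regular_at v f ->
  affine_regular_at v g -> affine_regular_at v (fun w => f w * g w).
Proof.
move=> [a [b [bv fE]]] [c [d [dv gE]]].
exists (a * c), (b * d); split.
  by rewrite /peval mevalM mulf_neq0.
by apply: filterS2 fE gE => w -> ->; rewrite mulf_div /peval !mevalM.
Qed.

Lemma affine_regular_at_neq0 v f : affine_regular_at v f -> f v != 0 ->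
  \forall w \near v, f w != 0.
Proof.
move=> [a [b [bv fE]]]; rewrite (nbhs_singleton fE) => av.
have av0 : peval a v != 0 by apply: contraNneq av => ->; rewrite mul0r.
apply: filterS3 fE (peval_near_neq0 av0) (peval_near_neq0 bv).
by move=> q -> aq bq; rewrite mulf_neq0 ?invr_eq0.
Qed.

Lemma affine_regular_atV v f : affine_regular_at v f -> f v != 0 ->
  affine_regular_at v (fun w => (f w)^-1).
Proof.
move=> [a [b [bv fE]]]; rewrite (nbhs_singleton fE) => av.
have av0 : peval a v != 0 by apply: contraNneq av => ->; rewrite mul0r.
exists b, a; split=> //.
by apply: filterS fE => q ->; rewrite invf_div.
Qed.

Definition affine_space : space k := Space affine_regular_at_near
  affine_regular_at_open affine_regular_at_cst affine_regular_atD
  affine_regular_atM affine_regular_at_neq0 affine_regular_atV.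

Lemma regular_at_coord i (v : affine_space) :
  regular_at v (fun w => coord (vbasis {:V}) i w).
Proof.
apply: affine_regular_at_near (peval_regular v (mpolyX _ (mnm1 i))).
by apply: near_all => w; rewrite /peval mevalXU.
Qed.

Lemma regular_at_linear (l : V -> k) (v : affine_space) :
  linear_for *%R l -> regular_at v l.
Proof.
move=> hl; pose L : {scalar V} := HB.pack l (GRing.isLinear.Build k V k *%R l hl).
have -> : l = fun w => \sum_i coord (vbasis {:V}) i w * l (vbasis {:V})`_i.
  apply/funext => w; rewrite {1}(coord_vbasis (memvf w)) -[LHS]/(L _) linear_sum.
  by apply: eq_bigr => i _; rewrite linearZ.
apply: regular_at_sum => i _; apply: regular_atM; first exact: regular_at_coord.
exact: regular_at_cst.
Qed.

Lemma morphism_to_affine (Z : space k) (f : Z -> affine_space) :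
  (forall z i, regular_at z (fun z => coord (vbasis {:V}) i (f z))) ->
  morphism f.
Proof.
move=> hf.
have rp z (p : poly) : regular_at z (fun z => peval p (f z)).
  rewrite /peval; apply: regular_at_eq (_ : regular_at z (fun z =>
    \sum_(m <- msupp p) mcoeff m p *
      \prod_i coord (vbasis {:V}) i (f z) ^+ fun_of_multinom m i)).
    by move=> t; rewrite mevalE.
  apply: regular_at_sum => m _; apply: regular_atM; first exact: regular_at_cst.
  by apply: regular_at_prod => i _; exact: regular_atX.
have cf : continuous f.
  move=> z A; rewrite nbhsE => -[B [[P BP] Bz] BA].
  have : ~ (~` B) (f z) by exact.
  rewrite BP => /existsNP[p /not_implyP[Pp /eqP pz]].
  apply: filterS (regular_at_neq0 (rp z p) pz) => t pt; apply: BA.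
  apply: contrapT => nBt; have : (~` B) (f t) by [].
  by rewrite BP => /(_ p Pp) /eqP; rewrite (negPf pt).
split=> // z g [a [b [bz gE]]].
apply: regular_at_near (regular_atM (rp z a) (regular_atV (rp z b) bz)).
have gE' : \forall t \near z, g (f t) = peval a (f t) / peval b (f t).
  exact: (cf z _ gE).
by apply: filterS gE' => t /= ->.
Qed.

End Affine.


Import VectorInternalTheory.

Section Varieties.
Variable k : closedFieldType.
Implicit Types X Y Z : space k.

Definition is_affine X : Prop := exists n (S : set (affine_space 'rV[k]_n)),
  closed S /\ isomorphic X (subspace S).

Definition separated X : Prop := closed [set p : product X X | p.1 = p.2].

Definition is_variety X : Prop := separated X /\
  exists (I : finType) (U : I -> set X),
    [/\ forall i, open (U i), forall i, is_affine (subspace (U i)) &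
        \bigcup_i U i = setT].

Lemma morphism_linear (V W : vectType k) (f : V -> W) : linear f ->
  morphism (f : affine_space V -> affine_space W).
Proof.
move=> lf; apply: morphism_to_affine => v i.
by apply: regular_at_linear => a x y; rewrite lf linearP.
Qed.

Lemma is_affine_closed X (V : vectType k) (S : set (affine_space V)) :
  closed S -> isomorphic X (subspace S) -> is_affine X.
Proof.
move=> cS XS; pose A := affine_space 'rV[k]_(dim V).
have mr : morphism (@r2v k V : A -> affine_space V).
  by apply: morphism_linear => a x y; rewrite linearP.
have mv : morphism (@v2r k V : affine_space V -> A).
  by apply: morphism_linear => a x y; rewrite linearP.
exists (dim V), ((r2v : A -> affine_space V) @^-1` S).
split; first exact: closed_preimage.
apply: isomorphic_trans XS _; apply: isomorphic_sym.
by apply: isomorphic_preimage mr mv _ _;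
  [exact: r2vK|exact: v2rK].
Qed.

Lemma is_affine_iso X Y : isomorphic X Y -> is_affine X -> is_affine Y.
Proof.
move=> XY [n [S [cS XS]]]; exists n, S; split=> //.
exact: isomorphic_trans (isomorphic_sym XY) XS.
Qed.

Lemma separated_affine_space (V : vectType k) : separated (affine_space V).
Proof.
pose A := affine_space V; rewrite /separated.
pose D i := [set p : product A A |
  coord (vbasis {:V}) i p.1 - coord (vbasis {:V}) i p.2 = 0].
rewrite (_ : [set _ | _] = \bigcap_i D i).
  apply: closed_bigI => i _; apply: closed_eq0 => p.
  by apply: regular_atB;
    [apply: (morphism_fst A A).2|apply: (morphism_snd A A).2];
    exact: regular_at_coord.
apply/seteqP; split=> [[v w] /= -> i _|[v w] /= h].
  by rewrite /D /= subrr.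
rewrite (coord_vbasis (memvf v)) (coord_vbasis (memvf w)).
apply: eq_bigr => i _; congr (_ *: _).
by have /eqP := h i I; rewrite /D /= subr_eq0 => /eqP.
Qed.

Lemma separated_inj X Y (f : X -> Y) :
  morphism f -> injective f -> separated Y -> separated X.
Proof.
move=> mf fI /(closed_preimage (morphism_prod mf mf)); congr closed.
by apply/seteqP; split=> [[x y] /fI|[x y] /= ->].
Qed.

Lemma is_affine_variety X : is_affine X -> is_variety X.
Proof.
move=> aX; have [n [S [cS [f [g [mf mg fK gK]]]]]] := aX; split.
  apply: (@separated_inj X (affine_space 'rV[k]_n) (val \o f)).
  - exact: (morphism_comp mf (@morphism_val _ _ S)).
  - by apply: inj_comp; [exact: val_inj|exact: can_inj fK].
  - exact: separated_affine_space.
exists unit, (fun=> setT); split=> [_|_|]; first exact: openT.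
- exact: is_affine_iso (isomorphic_sym (isomorphic_setT X)) aX.
- by apply/seteqP; split=> // x _; exists tt.
Qed.

Lemma isomorphic_affine_product (V W : vectType k) : isomorphic
  (product (affine_space V) (affine_space W)) (affine_space (V * W)%type).
Proof.
exists id, (fun q => (q.1, q.2)); split; [|by apply: (@morphism_pair _ (affine_space V) (affine_space W)
    (affine_space (V * W)%type) fst snd); apply: morphism_linear|by case|by case].
apply: morphism_to_affine => p i; set l := coord _ _.
have lD q : l q = l (q.1, 0) + l (0, q.2).
  by rewrite -linearD; congr l; case: q => v w; rewrite /= -[RHS]/(_, _) addr0 add0r.
apply: regular_at_eq (_ : regular_at p (fun q => l (q.1, 0) + l (0, q.2))).
  by move=> q; rewrite -lD.
apply: regular_atD.
  apply: ((morphism_fst _ _).2 p (fun v => l (v, 0))).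
  apply: regular_at_linear => a x y; rewrite -linearP; congr l.
  by apply: injective_projections; rewrite /= ?scaler0 ?addr0.
apply: ((morphism_snd _ _).2 p (fun w => l (0, w))).
apply: regular_at_linear => a x y; rewrite -linearP; congr l.
by apply: injective_projections; rewrite /= ?scaler0 ?addr0.
Qed.

Lemma closed_product X Y (S : set X) (T : set Y) :
  closed S -> closed T -> closed ((S `*` T) : set (product X Y)).
Proof.
move=> cS cT.
have -> : S `*` T = (fst : product X Y -> X) @^-1` S `&`
                    (snd : product X Y -> Y) @^-1` T by [].
by apply: closedI; apply: closed_preimage => //;
  [exact: morphism_fst|exact: morphism_snd].
Qed.

Lemma is_affine_product X Y :
  is_affine X -> is_affine Y -> is_affine (product X Y).
Proof.
move=> [n [S [cS XS]]] [m [T [cT YT]]].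
have [f [g [mf mg fK gK]]] := isomorphic_affine_product 'rV[k]_n 'rV[k]_m.
apply: (@is_affine_closed _ _ (g @^-1` (S `*` T))).
  by apply: closed_preimage mg _; exact: closed_product.
apply: isomorphic_trans (isomorphic_product XS YT) _.
apply: isomorphic_trans (isomorphic_sym (isomorphic_subproduct S T)) _.
exact: isomorphic_sym (isomorphic_preimage _ mg mf gK fK).
Qed.

Lemma separated_product X Y :
  separated X -> separated Y -> separated (product X Y).
Proof.
move=> sX sY.
have mX : morphism (fun p : product (product X Y) (product X Y) =>
    (p.1.1, p.2.1) : product X X).
  by apply: morphism_prod; exact: morphism_fst.
have mY : morphism (fun p : product (product X Y) (product X Y) =>
    (p.1.2, p.2.2) : product Y Y).
  by apply: morphism_prod; exact: morphism_snd.
have := closedI (closed_preimage mX sX) (closed_preimage mY sY).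
congr closed; apply/seteqP; split=> [[[x y] [x' y']] /= [-> ->] //|].
by move=> [[x y] [x' y']] /= [-> ->].
Qed.

Lemma is_variety_product X Y :
  is_variety X -> is_variety Y -> is_variety (product X Y).
Proof.
move=> [sX [I [U [oU aU cU]]]] [sY [J [W [oW aW cW]]]].
split; first exact: separated_product.
exists (I * J)%type, (fun s => U s.1 `*` W s.2); split=> [s|s|].
- have -> : U s.1 `*` W s.2 = (fst : product X Y -> X) @^-1` U s.1 `&`
                    (snd : product X Y -> Y) @^-1` W s.2 by [].
  by apply: openI; apply: open_preimage => //;
    [exact: morphism_fst|exact: morphism_snd].
- apply: is_affine_iso (isomorphic_sym (isomorphic_subproduct _ _)) _.
  exact: is_affine_product.
apply/seteqP; split=> // -[x y] _.
have [i _ Ux] : (\bigcup_i U i) x by rewrite cU.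
have [j _ Wy] : (\bigcup_j W j) y by rewrite cW.
by exists (i, j).
Qed.

(* Rabinowitsch's trick: a principal open subset of a closed subset of an
   affine space is affine *)
Lemma is_affine_principal (V : vectType k) (S : set (affine_space V))
    (f : affine_space V -> k) :
  closed S -> (forall v, regular_at v f) ->
  is_affine (subspace (S `&` [set v | f v != 0])).
Proof.
move=> cS rf; set D := _ `&` _; pose W : vectType k := (V * k^o)%type.
pose AW := affine_space W; pose AV := affine_space V.
have m1 : morphism (fst : AW -> AV) by apply: morphism_linear.
pose T : set AW := fst @^-1` S `&` [set p : AW | p.2 * f p.1 - 1 = 0].
have cT : closed T.
  apply: closedI; first exact: closed_preimage.
  apply: closed_eq0 => p; apply: regular_atB; last exact: regular_at_cst.
  apply: regular_atM; last exact: m1.2.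
  by apply: (@regular_at_linear _ W snd) => a x y.
have hT p : T p -> p.2 * f p.1 = 1 by move=> [_ /eqP]; rewrite subr_eq0 => /eqP.
apply: (is_affine_closed cT).
have mD := @morphism_val _ _ D.
pose a (x : subspace D) : AW := (val x, (f (val x))^-1).
have ma : morphism a.
  apply: morphism_to_affine => x i; set l := coord _ _.
  apply: regular_at_eq (_ : regular_at x (fun x =>
      l (val x, 0) + (f (val x))^-1 * l (0, 1))).
    move=> y; rewrite -[_ * _]/(_ *: _) -linearZ -linearD; congr l.
    by apply: injective_projections; rewrite /= ?scaler0 ?addr0 ?add0r //
      -[_ *: _]/(_ * _) mulr1.
  apply: regular_atD.
    apply: (mD.2 x (fun v => l (v, 0))); apply: regular_at_linear => c y z.
    by rewrite -linearP; congr l;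
    apply: injective_projections; rewrite /= ?scaler0 ?addr0.
  apply: regular_atM; last exact: regular_at_cst.
  apply: (mD.2 x (fun v => (f v)^-1)); apply: regular_atV => //.
  by have [] := @set_valP _ D x.
have ha x : T (a x).
  by have [Sx fx] := @set_valP _ D x; split=> //=; rewrite mulVf // subrr.
have hb (y : subspace T) : D ((fst \o val) y).
  have [Sy _] := @set_valP _ T y; have /hT hy := @set_valP _ T y.
  split=> //=; apply/eqP => fy; move/eqP: hy.
  by rewrite fy mulr0 eq_sym oner_eq0.
exists (to_sub ha), (to_sub hb); split.
- exact: morphism_sub.
- by apply: morphism_sub; apply: morphism_comp m1; exact: morphism_val.
- by move=> x; exact: val_inj.
- move=> y; apply: val_inj; have /hT := @set_valP _ T y.
  rewrite /= /a /=; case: (val y) => v t /= tv.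
  have fv : f v != 0.
    by apply/eqP => fv; move/eqP: tv; rewrite fv mulr0 eq_sym oner_eq0.
  by congr pair; apply: (mulIf fv); rewrite mulVf.
Qed.

Lemma isomorphic_product_pt X : isomorphic (product (affine_space 'rV[k]_0) X) X.
Proof.
exists snd, (fun x => (0, x)); split=> //.
- exact: morphism_snd.
- apply: (@morphism_pair k (affine_space 'rV[k]_0) X X (fun=> 0) id); last exact: morphism_id.
  by apply: morphism_to_affine => z i; exact: regular_at_cst.
- by case=> v x /=; congr pair; rewrite [RHS]thinmx0.
Qed.

End Varieties.

Record variety (k : closedFieldType) := Variety {
  variety_space :> space k;
  varietyP : is_variety variety_space
}.

Section VarietyConstructions.
Variable k : closedFieldType.

Lemma is_variety_affine_space (V : vectType k) : is_variety (affine_space V).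
Proof.
apply: is_affine_variety; apply: (@is_affine_closed _ _ V setT).
  exact: closedT.
exact/isomorphic_sym/isomorphic_setT.
Qed.

Definition affine_variety (V : vectType k) : variety k :=
  Variety (is_variety_affine_space V).

Definition product_variety (X Y : variety k) : variety k :=
  Variety (is_variety_product (varietyP X) (varietyP Y)).

End VarietyConstructions.

Section IsoClasses.
Variable k : closedFieldType.
Implicit Types X Y : variety k.

(* [variety k] lives in a universe too large for the free abelian group on it to
   be a ring of the library. But every variety has a copy whose points lie in the
   fixed type [label]; the isomorphism class of [X] is the set of the copies of
   [X] of this kind, so [isoclass] is the small set of isomorphism classes: see
   [class_ofP]. *)

Definition label : Type := (nat * seq k)%type.

Definition model : Type :=
  (set label * set (set label) * (label -> set (label -> k)))%type.

Definition transport X (phi : X -> label) : model :=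
  (range phi, [set A | open (phi @^-1` A)],
   fun w f => exists2 x, phi x = w & regular_at x (f \o phi)).

Definition iso_class X : set model :=
  [set m | exists2 phi : X -> label, injective phi & m = transport phi].

Lemma label_ex X : exists phi : X -> label, injective phi.
Proof.
have [_ [I [U [_ aU cU]]]] := varietyP X.
have loc i : exists e : X -> seq k,
    forall x y, U i x -> U i y -> e x = e y -> x = y.
  have [n [S [_ [f [g [_ _ fK _]]]]]] := aU i.
  pose t x (h : U i x) : subspace (U i) := exist _ x (mem_set h).
  exists (fun x => if pselect (U i x) is left h
    then [seq (val (f (t x h)) : 'rV[k]_n) 0 j | j <- enum 'I_n] else [::]).
  move=> x y Ux Uy; case: pselect => // hx; case: pselect => // hy exy.
  suff : t x hx = t y hy by move=> /(congr1 val).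
  apply: (can_inj fK); apply: val_inj; apply/rowP => j.
  by move/eq_in_map : exy; apply; rewrite mem_enum.
have {loc}[e he] := choice loc.
have /choice[c hc] : forall x, exists i, U i x.
  by move=> x; have [i _ ?] : (\bigcup_i U i) x by [rewrite cU]; exists i.
exists (fun x => (enum_rank (c x) : nat, e (c x) x)) => x y [/ord_inj/enum_rank_inj cxy].
by rewrite -cxy; apply: he => //; rewrite cxy.
Qed.

Lemma transport_morphism X Y (phi : X -> label) (psi : Y -> label) :
  injective phi -> injective psi -> transport phi = transport psi ->
  exists2 f : X -> Y, morphism f & forall x, psi (f x) = phi x.
Proof.
move=> phiI psiI tE.
have rE : range phi = range psi := congr1 (fun m : model => m.1.1) tE.
have /choice[f fE] : forall x, exists y, psi y = phi x.
  move=> x; have : range psi (phi x) by rewrite -rE; exists x.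
  by move=> [y _ <-]; exists y.
exists f => //; split=> [|x h rh].
  apply/continuousP => A oA.
  have psiA : psi @^-1` (psi @` A) = A.
    by apply/seteqP; split=> [y [z Az /psiI <-]//|y Ay]; exists y.
  have : (transport psi).1.2 (psi @` A) by rewrite /= psiA.
  rewrite -tE /=; congr open; apply/seteqP; split=> x /=.
    by rewrite -fE => -[z Az /psiI <-].
  by move=> Afx; exists (f x).
have /choice[r rP] : forall w, exists z : option Y,
    forall y, psi y = w -> z = Some y.
  move=> w; have [[y yw]|nw] := pselect (exists y, psi y = w).
    by exists (Some y) => z zw; congr Some; apply: psiI; rewrite zw.
  by exists None => y yw; case: nw; exists y.
pose H w := if r w is Some y then h y else 0.
have HE : H \o psi = h.
  by apply/funext => y; rewrite /H /= (rP _ y erefl).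
have : (transport psi).2 (psi (f x)) H by exists (f x) => //; rewrite HE.
rewrite -tE => -[x' + rx']; rewrite fE => /phiI xx'.
rewrite -{1}xx'; congr regular_at : rx'; apply/funext => z /=.
by rewrite -[in RHS]HE /= fE.
Qed.

Lemma iso_classP X Y : iso_class X = iso_class Y <-> isomorphic X Y.
Proof.
split=> [XY|].
  have [phi phiI] := label_ex X.
  have : iso_class Y (transport phi) by rewrite -XY; exists phi.
  move=> [psi psiI E].
  have [f mf fE] := transport_morphism phiI psiI E.
  have [g mg gE] := transport_morphism psiI phiI (esym E).
  exists f, g; split=> //.
  - by move=> x; apply: phiI; rewrite gE fE.
  - by move=> y; apply: psiI; rewrite fE gE.
suff sub X' Y' : isomorphic X' Y' -> iso_class X' `<=` iso_class Y'.
  by move=> XY; apply/seteqP; split; apply: sub => //; exact: isomorphic_sym.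
move=> [f [g [mf mg fK gK]]] m [phi phiI ->].
exists (phi \o g); first by apply: inj_comp => //; exact: can_inj gK.
congr (_, _, _).
- apply/seteqP; split=> w [z _ <-]; first by exists (f z); rewrite //= fK.
  by exists (g z).
- apply/seteqP; split=> A /= oA.
    by rewrite comp_preimage; exact: open_preimage.
  rewrite (_ : phi @^-1` A = f @^-1` ((phi \o g) @^-1` A)).
    exact: open_preimage.
  by apply/seteqP; split=> x /=; rewrite fK.
- apply/funext => w; apply/funext => h; apply/propext; split=> -[x <- rx].
    exists (f x); first by rewrite /= fK.
    by have := mg.2 (f x) (h \o phi); rewrite fK; exact.
  exists (g x) => //; have := mf.2 (g x) _; rewrite gK => /(_ _ rx).
  by congr regular_at; apply/funext => z; rewrite /= fK.
Qed.

Definition isoclass : Type :=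
  {C : set model | `[< exists X : variety k, C = iso_class X >]}.
HB.instance Definition _ := Choice.on isoclass.

Definition class_of X : isoclass :=
  exist _ (iso_class X) (asboolT (ex_intro _ X erefl)).

Lemma class_ofP X Y : class_of X = class_of Y <-> isomorphic X Y.
Proof.
rewrite -iso_classP; split=> [/(congr1 val)//|XY].
exact: val_inj.
Qed.

Definition repr_class (C : isoclass) : variety k :=
  projT1 (cid (asboolW (valP C))).

Lemma repr_classK : cancel repr_class class_of.
Proof.
by move=> C; apply: val_inj; rewrite /= /repr_class; case: cid.
Qed.

Definition class_one : isoclass := class_of (affine_variety 'rV[k]_0).

Definition class_mul (C D : isoclass) : isoclass :=
  class_of (product_variety (repr_class C) (repr_class D)).

Lemma class_mulE X Y :
  class_mul (class_of X) (class_of Y) = class_of (product_variety X Y).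
Proof.
by apply/class_ofP; apply: isomorphic_product; apply/class_ofP;
  rewrite repr_classK.
Qed.

Lemma class_mulA : associative class_mul.
Proof.
move=> C D E; rewrite -[C]repr_classK -[D]repr_classK -[E]repr_classK.
by rewrite !class_mulE; apply/class_ofP; exact: isomorphic_productA.
Qed.

Lemma class_mulC : commutative class_mul.
Proof.
move=> C D; rewrite -[C]repr_classK -[D]repr_classK !class_mulE.
by apply/class_ofP; exact: isomorphic_productC.
Qed.

Lemma class_mul1 : left_id class_one class_mul.
Proof.
move=> C; rewrite -[C]repr_classK class_mulE.
by apply/class_ofP; exact: isomorphic_product_pt.
Qed.

Lemma class_mulr1 : right_id class_one class_mul.
Proof. by move=> C; rewrite class_mulC class_mul1. Qed.

Lemma isomorphic_pt X (x0 : X) : (forall x, x = x0) ->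
  isomorphic X (affine_space 'rV[k]_0).
Proof.
move=> hx; exists (fun=> 0), (fun=> x0); split=> //.
- by apply: morphism_to_affine => x i; exact: regular_at_cst.
- split=> [v|v h _]; last exact: regular_at_cst.
  exact: cst_continuous.
- by move=> v; rewrite [RHS]thinmx0.
Qed.

Lemma class_unit C D : class_mul C D = class_one -> C = class_one /\ D = class_one.
Proof.
rewrite -[C]repr_classK -[D]repr_classK class_mulE.
set X := repr_class C; set Y := repr_class D.
move=> /class_ofP[f [g [_ _ fK _]]].
have [x0 y0] : product X Y := g 0.
have pI p q : p = q :> product X Y.
  by apply: (can_inj fK); rewrite [LHS]thinmx0 [RHS]thinmx0.
split; apply/class_ofP.
  by apply: (@isomorphic_pt _ x0) => x; case: (pI (x, y0) (x0, y0)).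
by apply: (@isomorphic_pt _ y0) => y; case: (pI (x0, y) (x0, y0)).
Qed.

HB.instance Definition _ := Choice_isMonomialDef.Build isoclass
  class_mulA class_mul1 class_mulr1 class_unit.
HB.instance Definition _ := MonomialDef_isConomialDef.Build isoclass class_mulC.

End IsoClasses.

Lemma mulrBDl (R : pzRingType) (a b c d : R) :
  (a - (b + c)) * d = a * d - (b * d + c * d).
Proof. by rewrite mulrBl mulrDl. Qed.

Local Open Scope quotient_scope.

Section GrothendieckRing.
Variable k : closedFieldType.
Implicit Types X Y : variety k.

(* [malg (isoclass k) int] is the free abelian group on [isoclass k], with the
   product that extends [class_mul], the product of varieties, bilinearly. *)
Definition free_ring : Type := malg (isoclass k) int.
HB.instance Definition _ := GRing.ComNzRing.on free_ring.

Definition gen X : free_ring := mkmalgU (class_of X) 1.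

(* [Z] and [U] are varieties isomorphic to the closed subset [S] of [X] and to its
   open complement, with the structures induced by [X]. *)
Definition scissor_relator : set free_ring :=
  [set r | exists (X U Z : variety k) (S : set X),
    [/\ closed S, isomorphic Z (subspace S), isomorphic U (subspace (~` S)) &
        r = gen X - (gen U + gen Z)]].

Definition scissor_subgroup : {pred free_ring} := [pred r |
  `[< forall J : {pred free_ring}, zmod_closed J ->
        (forall s, scissor_relator s -> s \in J) -> r \in J >]].

Lemma scissor_subgroupP r : reflect (forall J : {pred free_ring}, zmod_closed J ->
  (forall s, scissor_relator s -> s \in J) -> r \in J) (r \in scissor_subgroup).
Proof. exact: asboolP. Qed.

Lemma scissor_subgroup_zmod_closed : zmod_closed scissor_subgroup.
Proof.
split=> [|r s /scissor_subgroupP hr /scissor_subgroupP hs]; apply/scissor_subgroupP => J J_zmod Jsc.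
  by case: J_zmod.
by have [_ JB] := J_zmod; apply: JB; [exact: hr|exact: hs].
Qed.

HB.instance Definition _ :=
  GRing.isZmodClosed.Build free_ring scissor_subgroup scissor_subgroup_zmod_closed.

Lemma gen_mul X Y : gen X * gen Y = gen (product_variety X Y).
Proof.
rewrite /gen malgM_def fgmulUU mulr1; congr mkmalgU; exact: class_mulE.
Qed.

Lemma gen_iso X Y : isomorphic X Y -> gen X = gen Y.
Proof. by move=> /class_ofP XY; rewrite /gen XY. Qed.

Lemma scissor_subgroupW s : scissor_relator s -> s \in scissor_subgroup.
Proof. by move=> hs; apply/scissor_subgroupP => J _; exact. Qed.

Lemma scissor_gen s Y : scissor_relator s -> s * gen Y \in scissor_subgroup.
Proof.
move=> [X [U [Z [S [cS ZS US ->]]]]]; apply: scissor_subgroupW.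
pose P : set (product_variety X Y) := (fst : product X Y -> X) @^-1` S.
have prE (T : set X) (W : variety k) : isomorphic W (subspace T) ->
    isomorphic (product_variety W Y)
      (subspace ((fst : product X Y -> X) @^-1` T)).
  move=> WT.
  apply: isomorphic_trans (isomorphic_product WT (isomorphic_sym (isomorphic_setT Y))) _.
  apply: isomorphic_trans (isomorphic_sym (isomorphic_subproduct _ _)) _.
  by rewrite (_ : T `*` setT = fst @^-1` T);
    [exact: isomorphic_refl|apply/seteqP; split=> p // []].
exists (product_variety X Y), (product_variety U Y), (product_variety Z Y), P.
split.
- by apply: closed_preimage => //; exact: morphism_fst.
- exact: prE.
- exact: (prE _ _ US).
- by rewrite -!gen_mul; exact: mulrBDl.
Qed.

Lemma free_ring_ind (P : free_ring -> Prop) :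
  (forall X, P (gen X)) -> P 0 -> (forall x y, P x -> P y -> P (x - y)) ->
  forall x, P x.
Proof.
move=> Pg P0 PB.
have PN x : P x -> P (- x) by rewrite -[- x]sub0r; exact: PB.
have PD x y : P x -> P y -> P (x + y).
  by move=> Px Py; rewrite -[y]opprK; apply: PB => //; exact: PN.
have PM x n : P x -> P (x *+ n).
  by move=> Px; elim: n => [|n IHn]; rewrite ?mulr0n // mulrS; exact: PD.
move=> x; rewrite (monalgE x); elim/big_ind: _ => // C _.
have E z : mkmalgU C z = gen (repr_class C) *~ z.
  rewrite /gen repr_classK -[z in LHS]intz.
  by rewrite -(raddfMz (mkmalgU C)).
rewrite E; case: (monalg.mcoeff C x) => n; first exact/PM/Pg.
exact/PN/PM/Pg.
Qed.

Lemma scissor_subgroupM r s : r \in scissor_subgroup -> r * s \in scissor_subgroup.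
Proof.
elim/free_ring_ind: s r => [Y r||s t IHs IHt r hr].
- move=> /scissor_subgroupP/(_ [pred r | r * gen Y \in scissor_subgroup]); apply.
    split=> [|u v]; first by rewrite -topredE /= mul0r rpred0.
    by rewrite -!topredE /= mulrBl; exact: rpredB.
  by move=> u su; rewrite -topredE; exact: scissor_gen.
- by move=> r _; rewrite mulr0 rpred0.
- by rewrite mulrBr; apply: rpredB; [exact: IHs|exact: IHt].
Qed.

(* [K0 k] is a [comPzRingType]: that 1 != 0 in it is true, but neither proved
   nor needed here. *)
Definition K0 : Type := Quotient.quot scissor_subgroup.
HB.instance Definition _ := GRing.Zmodule.on K0.
HB.instance Definition _ := EqQuotient.on K0.

Lemma pi_K0P (r s : free_ring) : \pi_K0 r = \pi_K0 s <-> r - s \in scissor_subgroup.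
Proof.
rewrite Quotient.idealrBE; split=> [->//|/eqP].
exact.
Qed.

Definition K0_one : K0 := \pi_K0 1.
Definition K0_mul (x y : K0) : K0 := \pi_K0 (repr x * repr y).

Lemma K0_mulE (r s : free_ring) :
  K0_mul (\pi_K0 r) (\pi_K0 s) = \pi_K0 (r * s).
Proof.
apply/pi_K0P; set r' := repr _; set s' := repr _.
have hr : r' - r \in scissor_subgroup by apply/pi_K0P; rewrite reprK.
have hs : s' - s \in scissor_subgroup by apply/pi_K0P; rewrite reprK.
have -> : r' * s' - r * s = (r' - r) * s' + (s' - s) * r.
  by rewrite !mulrBl [s' * r]mulrC [s * r]mulrC addrA subrK.
by rewrite rpredD // scissor_subgroupM.
Qed.

Lemma K0_mulA : associative K0_mul.
Proof.
elim/quotW => x; elim/quotW => y; elim/quotW => z.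
by rewrite (K0_mulE y z) (K0_mulE x) (K0_mulE x y) (K0_mulE _ z) mulrA.
Qed.

Lemma K0_mulC : commutative K0_mul.
Proof.
elim/quotW => x; elim/quotW => y.
by rewrite (K0_mulE x y) (K0_mulE y x) mulrC.
Qed.

Lemma K0_mul1 : left_id K0_one K0_mul.
Proof. by elim/quotW => x; rewrite (K0_mulE 1 x) mul1r. Qed.

Lemma K0_piD (r s : free_ring) : \pi_K0 r + \pi_K0 s = \pi_K0 (r + s).
Proof. exact/esym/Quotient.pi_add. Qed.

Lemma K0_mulD : left_distributive K0_mul +%R.
Proof.
elim/quotW => x; elim/quotW => y; elim/quotW => z.
by rewrite (K0_piD x y) (K0_mulE _ z) (K0_mulE x z) (K0_mulE y z) K0_piD mulrDl.
Qed.

HB.instance Definition _ := GRing.Zmodule_isComPzRing.Build K0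
  K0_mulA K0_mulC K0_mul1 K0_mulD.

Definition virtual_class X : K0 := \pi_K0 (gen X).

Lemma virtual_class_iso X Y :
  isomorphic X Y -> virtual_class X = virtual_class Y.
Proof. by move=> /gen_iso XY; rewrite /virtual_class XY. Qed.

Lemma virtual_class_product X Y :
  virtual_class (product_variety X Y) = virtual_class X * virtual_class Y.
Proof. by rewrite /virtual_class -gen_mul; exact/esym/K0_mulE. Qed.

Lemma virtual_class_scissor X (U Z : variety k) (S : set X) : closed S ->
  isomorphic Z (subspace S) -> isomorphic U (subspace (~` S)) ->
  virtual_class X = virtual_class U + virtual_class Z.
Proof.
move=> cS ZS US; apply: etrans (esym (K0_piD _ _)).
by apply/pi_K0P/scissor_subgroupW; exists X, U, Z, S.
Qed.

End GrothendieckRing.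

Section CommutingTuples.
Variables (k : closedFieldType) (n : nat).

Definition matrix_tuples : vectType k := {ffun 'I_n -> 'M[k]_2}.

(* C_n(GL_2(k)), inside the affine space of [n]-tuples of 2 x 2 matrices *)
Definition commuting_GL2 : set (affine_space matrix_tuples) :=
  [set A : {ffun 'I_n -> 'M[k]_2} |
    (forall i, A i \in unitmx) /\
    (forall i j, A i *m A j = A j *m A i)].

Lemma regular_at_entry i a b (A : affine_space matrix_tuples) :
  regular_at A (fun B : {ffun 'I_n -> 'M[k]_2} => B i a b).
Proof.
by apply: (@regular_at_linear _ matrix_tuples) => c B C; rewrite !ffunE !mxE.
Qed.

Lemma commuting_GL2_affine : is_affine (subspace commuting_GL2).
Proof.
pose S : set (affine_space matrix_tuples) :=
  \bigcap_(s : 'I_n * 'I_n * ('I_2 * 'I_2)) [set A : {ffun 'I_n -> 'M[k]_2} |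
    (A s.1.1 *m A s.1.2) s.2.1 s.2.2 - (A s.1.2 *m A s.1.1) s.2.1 s.2.2 = 0].
pose d (A : {ffun 'I_n -> 'M[k]_2}) := \prod_i \det (A i).
have -> : commuting_GL2 = S `&` [set A | d A != 0].
  apply/seteqP; split=> A /= [].
    move=> uA cA; split=> [s _ /=|]; first by rewrite cA subrr.
    by apply/prodf_neq0 => i _; rewrite -unitfE -unitmxE.
  move=> cA /prodf_neq0 dA; split=> [i|i j]; first by rewrite unitmxE unitfE dA.
  apply/matrixP => a b; apply/eqP; rewrite -subr_eq0; apply/eqP.
  exact: (cA (i, j, (a, b)) I).
have rmul i j a b (A : affine_space matrix_tuples) :
    regular_at A (fun B : {ffun 'I_n -> 'M[k]_2} => (B i *m B j) a b).
  apply: regular_at_eq (_ : regular_at A (fun B : {ffun 'I_n -> 'M[k]_2} =>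
      \sum_c B i a c * B j c b)) => [B|]; first by rewrite mxE.
  apply: regular_at_sum => c _.
  by apply: regular_atM; exact: regular_at_entry.
apply: is_affine_principal.
  apply: closed_bigI => s _.
  by apply: closed_eq0 => A; apply: regular_atB; exact: rmul.
move=> A; apply: regular_at_prod => i _.
rewrite /determinant; apply: regular_at_sum => s _.
apply: regular_atM; first exact: regular_at_cst.
by apply: regular_at_prod => a _; exact: regular_at_entry.
Qed.

Definition commuting_GL2_variety : variety k :=
  Variety (is_affine_variety commuting_GL2_affine).

End CommutingTuples.

(* Main.v *)
From mathcomp Require Import all_boot all_order all_algebra.
From mathcomp Require Import boolp classical_sets functions topology.
From mathcomp Require Import ring.
Require Import Defs.

Set Implicit Arguments.
Unset Strict Implicit.
Unset Printing Implicit Defensive.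

Import GRing.Theory.
Local Open Scope classical_set_scope.
Local Open Scope ring_scope.

(** Cut C_(m+1) according to its first matrix A0. If A0 is scalar, what remains
    is a point of C_m, so this part has class (q - 1) [C_m]. If A0 is not scalar,
    its centralizer is the plane k[A0], and the other m matrices are arbitrary
    units x + y A0 of that plane. The norm of x + y A0 is x^2 + t x y + d y^2,
    where t and d are the trace and the determinant of A0; so everything depends
    on A0 through (t, d) only, and the problem becomes the computation, for a base
    S with two functions t and d, of the class of the tuples of m units of
    k[z]/(z^2 - t z + d) over S ([units_class]).

    The nonscalar A0 fall into three pieces, by the first of the entries 01, 10
    and the difference of the diagonal entries that is nonzero. In the first piece
    A0 is determined by (t, d) with d nonzero, a point of the line and a nonzero
    scalar; in the other two, by an ordered pair (a, e) of nonzero eigenvalues,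
    and a nonzero scalar in the second, with a and e distinct in the third
    ([commuting_classS]).

    Over the pairs (a, e) the polynomial splits: x + y z has the values x + y a
    and x + y e at its roots, which for a unit are an arbitrary pair of nonzero
    scalars when a and e are distinct ([units_class_split]), while for a = e only
    x + y a has to be nonzero ([units_class_ramified]). Over the pairs (t, d) the
    class of the units is found from their complement ([units_class_rec]): a
    nonzero x + y z that is not a unit has y nonzero, and - x / y is then a root
    of z^2 - t z + d. So the non-units are the zero section and a copy of the
    product of G_m with the set of pairs of a point of S and a root, and over the
    latter the polynomial splits. This recursion takes the place of a quotient by
    the group of order two that swaps the eigenvalues: only scissor relations,
    products and isomorphisms are used.

    It remains to solve the recursions: both sides of the theorem equal the
    combination in [commuting_closed] and [strata_transfer] of the four
    polynomials [strata]. *)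

(** * Regular functions and morphisms given by formulas *)

Notation line k := (affine_space (k^o : vectType k)).

Section Regular.
Variable k : closedFieldType.
Implicit Types X Y Z : space k.

Definition regular Z (f : Z -> k) : Prop := forall z, regular_at z f.

Lemma regular_cst Z c : regular (fun _ : Z => c).
Proof. by move=> z; exact: regular_at_cst. Qed.

Lemma regularD Z (f g : Z -> k) :
  regular f -> regular g -> regular (fun z => f z + g z).
Proof. by move=> rf rg z; exact: regular_atD. Qed.

Lemma regularN Z (f : Z -> k) : regular f -> regular (fun z => - f z).
Proof. by move=> rf z; exact: regular_atN. Qed.

Lemma regularM Z (f g : Z -> k) :
  regular f -> regular g -> regular (fun z => f z * g z).
Proof. by move=> rf rg z; exact: regular_atM. Qed.

Lemma regularX Z (f : Z -> k) n : regular f -> regular (fun z => f z ^+ n).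
Proof. by move=> rf z; exact: regular_atX. Qed.

Lemma regularV Z (f : Z -> k) :
  (forall z, f z != 0) -> regular f -> regular (fun z => (f z)^-1).
Proof. by move=> f0 rf z; exact: regular_atV. Qed.

Lemma regular_comp X Z (t : X -> k) (f : Z -> X) :
  regular t -> morphism f -> regular (fun z => t (f z)).
Proof. by move=> rt [_ mf] z; exact: (mf z t). Qed.

(** A coordinate of [f] in any basis of [W] is a linear combination of the
    coefficients [c i]. This reduces the maps to spaces of matrices and of tuples
    of matrices to their entries. *)
Lemma morphism_span Z (W : vectType k) (I : finType) (c : I -> Z -> k)
    (w : I -> W) (f : Z -> affine_space W) :
  (forall i, regular (c i)) -> (forall z, f z = \sum_i c i z *: w i) ->
  morphism f.
Proof.
move=> rc fE; apply: morphism_to_affine => z j.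
apply: regular_at_eq (_ : regular_at z (fun z =>
    \sum_i c i z * coord (vbasis {:W}) j (w i))) => [x|].
  by rewrite fE linear_sum; apply: eq_bigr => i _; rewrite linearZ.
apply: regular_at_sum => i _; apply: regular_atM; first exact: rc.
exact: regular_at_cst.
Qed.

Lemma morphism_line Z (f : Z -> k) : regular f -> morphism (f : Z -> line k).
Proof.
move=> rf; apply: (@morphism_span Z k^o unit (fun=> f) (fun=> 1)) => // z.
by rewrite big_const card_unit /= addr0 -[RHS]/(f z * 1) mulr1.
Qed.

Lemma regular_line Z (f : Z -> k) : morphism (f : Z -> line k) -> regular f.
Proof.
move=> [_ mf] z; apply: (mf z id).
by apply: (@regular_at_linear _ k^o).
Qed.

Lemma morphism_mx Z m n (f : Z -> affine_space 'M[k]_(m, n)) :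
  (forall i j, regular (fun z => (f z : 'M[k]_(m, n)) i j)) -> morphism f.
Proof.
move=> rf; apply: (@morphism_span Z _ ('I_m * 'I_n)%type
  (fun ij z => (f z : 'M[k]_(m, n)) ij.1 ij.2) (fun ij => delta_mx ij.1 ij.2)).
  by move=> ij; exact: rf.
by move=> z; rewrite [LHS]matrix_sum_delta pair_big.
Qed.

Lemma regular_mx Z m n (f : Z -> affine_space 'M[k]_(m, n)) i j :
  morphism f -> regular (fun z => (f z : 'M[k]_(m, n)) i j).
Proof.
move=> [_ mf] z; apply: (mf z (fun A : 'M[k]_(m, n) => A i j)).
by apply: (@regular_at_linear _ 'M[k]_(m, n)) => c A B; rewrite !mxE.
Qed.

Lemma morphism_tuples Z n (f : Z -> affine_space (matrix_tuples k n)) :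
  (forall i a b, regular (fun z => (f z : {ffun 'I_n -> 'M[k]_2}) i a b)) ->
  morphism f.
Proof.
move=> rf; apply: (@morphism_span Z _ ('I_n * ('I_2 * 'I_2))%type
  (fun s z => (f z : {ffun 'I_n -> 'M[k]_2}) s.1 s.2.1 s.2.2)
  (fun s => [ffun i => if i == s.1 then delta_mx s.2.1 s.2.2 else 0])).
  by move=> s; exact: rf.
move=> z; apply/ffunP => i; rewrite sum_ffunE.
rewrite [LHS]matrix_sum_delta pair_big /=.
rewrite -(pair_big xpredT xpredT (fun j s =>
  ((f z : {ffun 'I_n -> 'M[k]_2}) j s.1 s.2 *:
   [ffun i0 => if i0 == j then delta_mx s.1 s.2 else 0 : 'M[k]_2]) i)) /=.
rewrite (bigD1 i) //= [X in _ + X]big1 ?addr0 => [|j ji].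
  by apply: eq_bigr => s _; rewrite !ffunE eqxx.
by apply: big1 => s _; rewrite !ffunE eq_sym (negPf ji) scaler0.
Qed.

Lemma regular_tuples Z n (f : Z -> affine_space (matrix_tuples k n)) i a b :
  morphism f -> regular (fun z => (f z : {ffun 'I_n -> 'M[k]_2}) i a b).
Proof.
move=> [_ mf] z.
by apply: (mf z (fun A : {ffun 'I_n -> 'M[k]_2} => A i a b)); exact: regular_at_entry.
Qed.

Lemma morphism_tuple Z n (f : Z -> affine_space (matrix_tuples k n)) i :
  morphism f ->
  morphism ((fun z => (f z : {ffun 'I_n -> 'M[k]_2}) i) :
    Z -> affine_space 'M[k]_2).
Proof. by move=> mf; apply: morphism_mx => a b; exact: regular_tuples. Qed.

(** [morphism_comp] in a form that unifies with a formula in [z]; likewise for the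
    next three lemmas. *)
Lemma morphism_comp_at X Y Z (f : X -> Y) (h : Z -> X) :
  morphism f -> morphism h -> morphism (fun z => f (h z)).
Proof. by move=> mf mh; exact: morphism_comp mh mf. Qed.

Lemma morphism_fst_comp Z X Y (f : Z -> product X Y) :
  morphism f -> morphism (fun z => (f z).1).
Proof. by move=> mf; exact: morphism_comp mf (@morphism_fst _ X Y). Qed.

Lemma morphism_snd_comp Z X Y (f : Z -> product X Y) :
  morphism f -> morphism (fun z => (f z).2).
Proof. by move=> mf; exact: morphism_comp mf (@morphism_snd _ X Y). Qed.

Lemma morphism_val_comp Z X (S : set X) (f : Z -> subspace S) :
  morphism f -> morphism (fun z => val (f z)).
Proof. by move=> mf; exact: morphism_comp mf (@morphism_val _ X S). Qed.

(** The formula [f] makes sense on all of [X], but is a morphism along [S] only. *)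
Lemma morphism_restrict X Y Z (S : set X) (f : X -> Y) (h : Z -> X) :
  morphism (fun x : subspace S => f (val x)) -> morphism h ->
  (forall z, S (h z)) -> morphism (fun z => f (h z)).
Proof. by move=> mf mh hS; exact: morphism_comp (morphism_sub hS mh) mf. Qed.

End Regular.

(** Proves regularity of formulas by following their syntax; the side condition
    that a denominator does not vanish is taken from the context, or left. *)
Ltac regularity :=
  lazymatch goal with
  | |- forall _, _ => intro; regularity
  | |- regular _ => first
    [ assumption
    | apply: regular_cst
    | apply: regularD; regularity
    | apply: regularN; regularity
    | apply: regularM; regularity
    | apply: regularX; regularity
    | match goal with H : regular ?t |- _ =>
        apply: (regular_comp H); regularity end
    | apply: regularV; [try (by []) | regularity]
    | apply: regular_tuples; regularity
    | apply: regular_mx; regularity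
    | apply: regular_line; regularity ]
  | |- morphism _ => first
    [ assumption
    | apply: morphism_id
    | apply: morphism_val
    | apply: morphism_pair; regularity
    | apply: morphism_fst_comp; regularity
    | apply: morphism_snd_comp; regularity
    | apply: morphism_val_comp; regularity
    | match goal with H : morphism ?f |- _ =>
        apply: (morphism_comp_at H); regularity end
    | apply: morphism_line; regularity
    | apply: morphism_tuple; regularity ]
  | |- _ => idtac
  end.

(** * Classes of affine subsets *)

Section AffineSets.
Variable k : closedFieldType.
Implicit Types X Y Z : space k.

Definition affine_set X (S : set X) : Prop := is_affine (subspace S).

(** Keeping [f] and [g] total on the ambient spaces lets them be written as
    formulas, with division by 0 outside of [S] and [T]. *)
Lemma isomorphic_sub X Y (S : set X) (T : set Y) (f : X -> Y) (g : Y -> X) :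
  morphism (fun x : subspace S => f (val x)) ->
  morphism (fun y : subspace T => g (val y)) ->
  (forall x, S x -> T (f x) /\ g (f x) = x) ->
  (forall y, T y -> S (g y) /\ f (g y) = y) ->
  isomorphic (subspace S) (subspace T).
Proof.
move=> mf mg fS gT.
have hf (x : subspace S) : T (f (val x)) by apply: (fS _ _).1; exact: set_valP.
have hg (y : subspace T) : S (g (val y)) by apply: (gT _ _).1; exact: set_valP.
exists (to_sub hf), (to_sub hg); split; try exact: morphism_sub.
- by move=> x; apply: val_inj; apply: (fS _ _).2; exact: set_valP.
- by move=> y; apply: val_inj; apply: (gT _ _).2; exact: set_valP.
Qed.

Lemma isomorphic_subsub X (S T : set X) :
  isomorphic (subspace ((val : subspace S -> X) @^-1` T)) (subspace (S `&` T)).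
Proof.
set U := _ @^-1` _.
have hf (x : subspace U) : (S `&` T) (val (val x)).
  by split; [exact: (@set_valP _ S)|exact: (@set_valP _ U x)].
have hg (x : subspace (S `&` T)) : S (val x).
  by have [] := @set_valP _ (S `&` T) x.
have hg' (x : subspace (S `&` T)) : U (to_sub hg x).
  by have [] := @set_valP _ (S `&` T) x.
exists (to_sub hf), (to_sub hg'); split.
- by apply: morphism_sub; regularity.
- by apply/morphism_sub/morphism_sub; regularity.
- by move=> x; do 2!apply: val_inj.
- by move=> x; apply: val_inj.
Qed.

Lemma closed_sub X (S A : set X) (T : set (subspace S)) : closed S ->
  closed T -> A = val @` T -> closed A.
Proof.
move=> cS cT ->.
have [B oB BT] : exists2 B : set X, open B & val @^-1` B = ~` T.
  have : open (~` T) by exact: closed_openC.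
  by move=> [B oB BT]; exists B.
rewrite (_ : _ @` _ = S `&` ~` B).
  by apply: closedI => //; exact: open_closedC.
apply/seteqP; split=> [_ [y Ty <-]|x [Sx nBx]].
  split; first exact: (@set_valP _ S).
  by move=> By; have : (~` T) y by rewrite -BT.
pose y : subspace S := exist _ x (mem_set Sx); exists y => //.
apply: contrapT => nTy; apply: nBx.
by have : (val @^-1` B) y by rewrite BT.
Qed.

(** An isomorphism of [X] with a closed subset [S] of an affine space carries [T]
    to a closed subset of [S], which is closed in the affine space as well. *)
Lemma is_affine_sub X (T : set X) :
  is_affine X -> closed T -> is_affine (subspace T).
Proof.
move=> [n [S [cS [f [g [mf mg fK gK]]]]]] cT.
pose T' := g @^-1` T; have cT' : closed T' by exact: closed_preimage.
exists n, (val @` T'); split; first exact: closed_sub cS cT' _.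
have iT := isomorphic_preimage T mg mf gK fK.
apply: isomorphic_trans (isomorphic_sym iT) _.
have -> : g @^-1` T = (val : subspace S -> _) @^-1` (val @` T').
  by apply/seteqP; split=> [y Ty|y [z Tz /val_inj <-]] //; exists y.
apply: isomorphic_trans (isomorphic_subsub _ _) _.
rewrite (_ : S `&` _ = val @` T'); first exact: isomorphic_refl.
apply/seteqP; split=> [y []//|_ [y Ty <-]]; split; last by exists y.
exact: (@set_valP _ S).
Qed.

Lemma is_affine_line : is_affine (line k).
Proof.
apply: (@is_affine_closed _ _ _ setT); first exact: closedT.
exact/isomorphic_sym/isomorphic_setT.
Qed.

(** Rabinowitsch's trick, for a function that is only given on [X]: the locus
    where [f] is nonzero is the closed subset [f x * y = 1] of the product of
    [X] and the line. *)
Lemma is_affine_neq0 X (f : X -> k) :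
  is_affine X -> regular f -> is_affine (subspace [set x | f x != 0]).
Proof.
move=> aX rf; set S := [set x | _].
pose T : set (product X (line k)) := [set p | f p.1 * p.2 - 1 = 0].
have rT : regular (fun p : product X (line k) => f p.1 * p.2 - 1) by regularity.
have cT : closed T by exact: closed_eq0 rT.
have aT := is_affine_sub (is_affine_product aX is_affine_line) cT.
apply: is_affine_iso aT.
apply: (@isomorphic_sub _ _ T S fst (fun x => (x, (f x)^-1))).
- by regularity.
- by regularity => z; exact: (@set_valP _ S z).
- move=> [x y] /= /eqP; rewrite subr_eq0 => /eqP fxy.
  have fx : f x != 0.
    by apply/eqP => fx; move/eqP: fxy; rewrite fx mul0r eq_sym oner_eq0.
  by split=> //; congr pair; apply: (mulfI fx); rewrite fxy mulfV.
- by move=> x fx; split=> //; rewrite /T /= mulfV // subrr.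
Qed.

Lemma affine_set_eq0 X (S : set X) (f : X -> k) :
  affine_set S -> regular f -> affine_set (S `&` [set x | f x = 0]).
Proof.
move=> aS rf; apply: is_affine_iso (isomorphic_subsub _ _) _.
apply: is_affine_sub aS _; apply: (@closed_eq0 _ (subspace S) (f \o val)).
by rewrite -/(regular _) /=; regularity.
Qed.

Lemma affine_set_neq0 X (S : set X) (f : X -> k) :
  affine_set S -> regular f -> affine_set (S `&` [set x | f x != 0]).
Proof.
move=> aS rf; apply: is_affine_iso (isomorphic_subsub _ _) _.
apply: (@is_affine_neq0 (subspace S) (f \o val)) => //=.
by regularity.
Qed.

Lemma affine_setT X : is_affine X -> affine_set [set: X].
Proof. exact/is_affine_iso/isomorphic_sym/isomorphic_setT. Qed.

Lemma affine_setX X Y (S : set X) (T : set Y) :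
  affine_set S -> affine_set T -> affine_set (S `*` T : set (product X Y)).
Proof.
move=> aS aT; apply: is_affine_iso (is_affine_product aS aT).
exact/isomorphic_sym/isomorphic_subproduct.
Qed.

(** The class of a subset that is an affine variety, totalized by 0: subsets of
    spaces with concrete coordinates can then be cut and compared without
    carrying along a proof that they are varieties. *)
Definition class X (S : set X) : K0 k :=
  if pselect (affine_set S) is left aS
  then virtual_class (Variety (is_affine_variety aS)) else 0.

Lemma classE X (S : set X) (Y : variety k) : affine_set S ->
  isomorphic Y (subspace S) -> virtual_class Y = class S.
Proof.
by move=> aS YS; rewrite /class; case: pselect => [aS'|//]; exact: virtual_class_iso.
Qed.

Lemma class_iso X Y (S : set X) (T : set Y) :
  isomorphic (subspace S) (subspace T) -> class S = class T.
Proof.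
move=> ST; rewrite [RHS]/class; case: pselect => [aT|naT].
  apply/esym/classE; last exact: isomorphic_sym.
  exact: is_affine_iso (isomorphic_sym ST) aT.
rewrite /class; case: pselect => [aS|//].
by case: naT; exact: is_affine_iso ST aS.
Qed.

(** Both pieces are affine, the nonvanishing locus by [is_affine_neq0]; this is
    the only form in which the scissor relation is used. *)
Lemma class_scissor X (S : set X) (f : X -> k) : affine_set S -> regular f ->
  class S = class (S `&` [set x | f x != 0]) + class (S `&` [set x | f x = 0]).
Proof.
move=> aS rf; have aU := affine_set_neq0 aS rf; have aZ := affine_set_eq0 aS rf.
rewrite -(classE (Y := Variety (is_affine_variety aU)) aU (isomorphic_refl _)).
rewrite -(classE (Y := Variety (is_affine_variety aZ)) aZ (isomorphic_refl _)).
rewrite -(classE (Y := Variety (is_affine_variety aS)) aS (isomorphic_refl _)).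
apply: (@virtual_class_scissor _ (Variety (is_affine_variety aS)) _ _
  ((val : subspace S -> X) @^-1` [set x | f x = 0])).
- by apply: (@closed_eq0 _ (subspace S) (f \o val)); rewrite -/(regular _); regularity.
- exact/isomorphic_sym/isomorphic_subsub.
- apply: isomorphic_sym; rewrite (_ : ~` _ = val @^-1` [set x | f x != 0]).
    exact: isomorphic_subsub.
  by apply/seteqP; split=> x /eqP.
Qed.

Lemma classX X Y (S : set X) (T : set Y) : affine_set S -> affine_set T ->
  class (S `*` T : set (product X Y)) = class S * class T.
Proof.
move=> aS aT.
rewrite -(classE (Y := Variety (is_affine_variety aS)) aS (isomorphic_refl _)).
rewrite -(classE (Y := Variety (is_affine_variety aT)) aT (isomorphic_refl _)).
rewrite -virtual_class_product; apply/esym/classE; first exact: affine_setX.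
exact/isomorphic_sym/isomorphic_subproduct.
Qed.

End AffineSets.

(** * Tuples of units of a quadratic algebra *)

Notation plane X := (product (product X (line _)) (line _)).

Section Units.
Variable k : closedFieldType.
Implicit Types X Y Z : space k.

(** The norm of [x + y z] in k[z]/(z^2 - t z + d): it vanishes exactly on the
    elements that are not units. *)
Definition qnorm (t d x y : k) : k := x ^+ 2 + t * x * y + d * y ^+ 2.

Definition unit_set X (t d : X -> k) (S : set X) : set (plane X) :=
  [set p | S p.1.1 /\ qnorm (t p.1.1) (d p.1.1) p.1.2 p.2 != 0].

(** The class of the tuples of [m] units over [S]. The first unit is absorbed into
    the base before the recursive call, so that a property of one step, proved
    over all bases, extends to [m] steps by induction. *)
Fixpoint units_class m X (t d : X -> k) (S : set X) : K0 k :=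
  if m is m'.+1 then
    @units_class m' (plane X)
      (fun p : plane X => t p.1.1) (fun p : plane X => d p.1.1) (unit_set t d S)
  else class S.

(** An isomorphism of [S] with [T] that identifies the two quadratic algebras. *)
Definition iso_over X Y (t d : X -> k) (S : set X) (t' d' : Y -> k) (T : set Y) :=
  exists (f : X -> Y) (g : Y -> X),
  [/\ morphism (fun x : subspace S => f (val x)),
      morphism (fun y : subspace T => g (val y)),
      forall x, S x -> [/\ T (f x), g (f x) = x, t' (f x) = t x & d' (f x) = d x]
    & forall y, T y -> S (g y) /\ f (g y) = y].

Lemma iso_over_unit_set X Y t d S t' d' T :
  @iso_over X Y t d S t' d' T ->
  iso_over (fun p : plane X => t p.1.1) (fun p => d p.1.1) (unit_set t d S)
           (fun p : plane Y => t' p.1.1) (fun p => d' p.1.1) (unit_set t' d' T).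
Proof.
move=> [f [g [mf mg fS gT]]].
exists (fun p : plane X => ((f p.1.1, p.1.2), p.2)).
exists (fun p : plane Y => ((g p.1.1, p.1.2), p.2)).
have mf' : morphism (fun p : subspace (unit_set t d S) => f (val p).1.1).
  apply: (morphism_restrict mf); first by regularity.
  by move=> p; have [] := @set_valP _ (unit_set t d S) p.
have mg' : morphism (fun p : subspace (unit_set t' d' T) => g (val p).1.1).
  apply: (morphism_restrict mg); first by regularity.
  by move=> p; have [] := @set_valP _ (unit_set t' d' T) p.
split.
- by regularity.
- by regularity.
- move=> [[x u] v] [/= /fS[Tf gf tf df] N0]; rewrite gf; split=> //.
  by split; rewrite //= tf df.
- move=> [[y u] v] [/= /gT[Sg fg] N0]; rewrite fg; split=> //; split=> //=.
  by have [_ _ tE dE] := fS _ Sg; rewrite -tE -dE fg.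
Qed.

Lemma units_class_iso m X Y t d S t' d' T :
  @iso_over X Y t d S t' d' T -> units_class m t d S = units_class m t' d' T.
Proof.
elim: m X Y t d S t' d' T => [|m IHm] X Y t d S t' d' T /=.
  move=> [f [g [mf mg fS gT]]]; apply: class_iso.
  by apply: (isomorphic_sub mf mg) => // x /fS[].
by move=> /iso_over_unit_set/IHm.
Qed.

Lemma affine_unit_set X (t d : X -> k) (S : set X) :
  regular t -> regular d -> affine_set S -> affine_set (unit_set t d S).
Proof.
move=> rt rd aS.
have aT : affine_set [set: line k] by apply: affine_setT; exact: is_affine_line.
pose N (p : plane X) : k :=
  qnorm (t p.1.1) (d p.1.1) p.1.2 p.2.
have rN : regular N by rewrite /N /qnorm; regularity.
have := affine_set_neq0 (affine_setX (affine_setX aS aT) aT) rN.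
by congr affine_set; apply/seteqP; split=> [p [[[]]]|p []].
Qed.

Lemma units_class_scissor m X (t d : X -> k) (S : set X) (f : X -> k) :
  regular t -> regular d -> affine_set S -> regular f ->
  units_class m t d S =
    units_class m t d (S `&` [set x | f x != 0]) +
    units_class m t d (S `&` [set x | f x = 0]).
Proof.
elim: m X t d S f => [|m IHm] X t d S f rt rd aS rf /=.
  exact: class_scissor.
have rt' : regular (fun p : plane X => t p.1.1) by regularity.
have rd' : regular (fun p : plane X => d p.1.1) by regularity.
have rf' : regular (fun p : plane X => f p.1.1) by regularity.
rewrite (IHm _ _ _ _ _ rt' rd' (affine_unit_set rt rd aS) rf').
have E (A : set k) : unit_set t d S `&` [set p | A (f p.1.1)] =
    unit_set t d (S `&` [set x | A (f x)]).
  by apply/seteqP; split=> [p [[? ?] ?]|p [[? ?] ?]].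
by rewrite (E [set c | c != 0]) (E [set 0]).
Qed.

(** The factor [T] moves past the coordinates of each new unit. *)
Lemma units_classX m X Y (t d : X -> k) (S : set X) (T : set Y) :
  regular t -> regular d -> affine_set S -> affine_set T ->
  units_class m (fun p : product X Y => t p.1) (fun p => d p.1) (S `*` T) =
    units_class m t d S * class T.
Proof.
elim: m X t d S => [|m IHm] X t d S rt rd aS aT /=; first exact: classX.
have rt' : regular (fun p : plane X => t p.1.1) by regularity.
have rd' : regular (fun p : plane X => d p.1.1) by regularity.
rewrite -(IHm _ _ _ _ rt' rd' (affine_unit_set rt rd aS) aT).
apply: units_class_iso.
exists (fun p : plane (product X Y) => (((p.1.1.1, p.1.2), p.2), p.1.1.2)).
exists (fun p : product (plane X) Y => (((p.1.1.1, p.2), p.1.1.2), p.1.2)).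
split; try by regularity.
  by move=> [[[x y] u] v] [[/= Sx Ty] N0].
by move=> [[[x u] v] y] [[/= Sx N0] Ty].
Qed.

Local Notation L := (class [set: line k]).
Definition Gm : set (line k) := [set x : k | x != 0].

Lemma affine_line : affine_set [set: line k].
Proof. by apply: affine_setT; exact: is_affine_line. Qed.

Lemma affine_Gm : affine_set Gm.
Proof.
have := @affine_set_neq0 _ _ _ (id : line k -> k) affine_line _.
by rewrite setTI; apply; regularity.
Qed.

Lemma class_pt X (x : X) : class [set x] = 1.
Proof.
have iP : isomorphic (affine_variety 'rV[k]_0) (subspace [set x]).
  apply: isomorphic_sym.
  exists (fun=> 0), (@to_sub _ _ [set x] (affine_space 'rV[k]_0) (fun=> x) (fun=> erefl)); split.
  - by apply: morphism_mx => i j; regularity.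
  - apply: morphism_sub; split=> [v|v h _]; last exact: regular_at_cst.
    exact: cst_continuous.
  - by move=> y; apply: val_inj; have := @set_valP _ [set x] y.
  - by move=> v; rewrite [RHS]thinmx0.
rewrite -(classE _ iP) //.
apply: is_affine_iso iP _; apply: (@is_affine_closed _ _ _ setT); first exact: closedT.
exact/isomorphic_sym/isomorphic_setT.
Qed.

Lemma class_Gm : class Gm = L - 1.
Proof.
have ri : regular (id : line k -> k) by regularity.
rewrite (class_scissor affine_line ri) !setTI -[1](@class_pt (line k) (0 : k)).
exact: (esym (addrK _ _)).
Qed.

Definition root_set X (t d : X -> k) (S : set X) : set (product X (line k)) :=
  [set p | S p.1 /\ (p.2 : k) ^+ 2 - t p.1 * p.2 + d p.1 = 0].

(** Cut the plane over [S] by the norm. The units form one part. A non-unit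
    [x + y z] with [y = 0] is zero, and one with [y != 0] is determined by [y]
    and by the root [- x / y] of the quadratic polynomial. *)
Lemma units_class_rec m X (t d : X -> k) (S : set X) :
  regular t -> regular d -> affine_set S ->
  units_class m.+1 t d S = (L ^+ 2 - 1) * units_class m t d S -
    (L - 1) * units_class m (fun p : product X (line k) => t p.1) (fun p => d p.1)
      (root_set t d S).
Proof.
move=> rt rd aS; have aT := affine_line.
pose W : set (plane X) := (S `*` setT) `*` setT.
have aW : affine_set W by apply: affine_setX => //; exact: affine_setX.
pose N (p : plane X) : k :=
  qnorm (t p.1.1) (d p.1.1) p.1.2 p.2.
have rN : regular N by rewrite /N /qnorm; regularity.
pose y (p : plane X) : k := p.2.
have ry : regular y by rewrite /y; regularity.
pose t' (p : plane X) := t p.1.1.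
pose d' (p : plane X) := d p.1.1.
have rt' : regular t' by rewrite /t'; regularity.
have rd' : regular d' by rewrite /d'; regularity.
have EW : units_class m t' d' W = units_class m t d S * L ^+ 2.
  have rt1 : regular (fun p : product X (line k) => t p.1) by regularity.
  have rd1 : regular (fun p : product X (line k) => d p.1) by regularity.
  rewrite /W (units_classX m rt1 rd1 (affine_setX aS aT) aT).
  by rewrite (units_classX m rt rd aS aT) mulrA.
have := units_class_scissor m rt' rd' aW rN.
rewrite EW (units_class_scissor m rt' rd' (affine_set_eq0 aW rN) ry).
have -> : W `&` [set x | N x != 0] = unit_set t d S.
  by apply/seteqP; split=> [p [[[]]]|p []].
have -> : units_class m t' d' (W `&` [set x | N x = 0] `&` [set x | y x = 0]) =
    units_class m t d S.
  apply: units_class_iso.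
  exists (fun p : plane X => p.1.1), (fun x => ((x, 0), 0)); split; try by regularity.
    move=> [[x u] v] [[[[/= Sx _] _] +] yv]; move: yv; rewrite /y /= => ->.
    rewrite /N /qnorm /= mulr0 expr0n mulr0 !addr0 => /eqP.
    by rewrite expf_eq0 /= => /eqP->.
  by move=> x Sx; split=> //; do !split=> //; rewrite /N /qnorm /= expr0n !mulr0 !addr0.
have -> : units_class m t' d' (W `&` [set x | N x = 0] `&` [set x | y x != 0]) =
    units_class m (fun p : product X (line k) => t p.1) (fun p => d p.1)
      (root_set t d S) * class Gm.
  have rt1 : regular (fun p : product X (line k) => t p.1) by regularity.
  have rd1 : regular (fun p : product X (line k) => d p.1) by regularity.
  have aR : affine_set (root_set t d S).
    pose r (p : product X (line k)) : k := (p.2 : k) ^+ 2 - t p.1 * p.2 + d p.1.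
    have rr : regular r by rewrite /r; regularity.
    have := affine_set_eq0 (affine_setX aS aT) rr.
    by congr affine_set; apply/seteqP; split=> [p [[]]|p []].
  rewrite -(units_classX m rt1 rd1 aR affine_Gm).
  apply: units_class_iso.
  exists (fun p : plane X => ((p.1.1, - (p.1.2 : k) / p.2), p.2)).
  exists (fun p : plane X => ((p.1.1, - (p.1.2 : k) * p.2), p.2)); split.
  - regularity.
    by move=> z; have [_] := @set_valP _ (W `&` [set x | N x = 0] `&` [set x | y x != 0]) z.
  - by regularity.
  - move=> [[x u] v] [[[[/= Sx _] _] N0] /= v0].
    rewrite /y /= in v0; rewrite /N /qnorm /= in N0; split=> //; last first.
      by congr (_, _, _); rewrite mulNr divfK ?opprK.
    split=> //; split=> //=.
    by apply: (mulfI (expf_neq0 2 v0)); rewrite mulr0 -[RHS]N0; field.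
  - move=> [[x u] v] [[/= Sx E] v0]; rewrite /Gm /= in v0; split; last first.
      by congr (_, _, _); rewrite mulNr mulfK ?opprK.
    do !split=> //; rewrite /N /qnorm /=.
    by rewrite -[RHS](mulr0 (v ^+ 2)) -E; ring.
rewrite class_Gm => E.
by rewrite mulrBl [_ * units_class m t d S]mulrC E; ring.
Qed.

(** When the polynomial has the distinct roots [a] and [e], evaluation at the two
    roots identifies the algebra with k x k. *)
Lemma units_class_split m X (a e t d : X -> k) (S : set X) :
  regular a -> regular e -> affine_set S ->
  (forall x, S x -> [/\ t x = a x + e x, d x = a x * e x & a x != e x]) ->
  units_class m t d S = class S * (L - 1) ^+ (2 * m).
Proof.
elim: m X a e t d S => [|m IHm] X a e t d S ra re aS H /=.
  by rewrite mulr1.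
pose T : set (plane X) := (S `*` Gm) `*` Gm.
have iS : isomorphic (subspace (unit_set t d S)) (subspace T).
  apply: (@isomorphic_sub _ (plane X) (plane X) (unit_set t d S) T
    (fun p : plane X => ((p.1.1, (p.1.2 : k) + p.2 * a p.1.1), (p.1.2 : k) + p.2 * e p.1.1))
    (fun p : plane X =>
      ((p.1.1, (p.1.2 : k) - ((p.1.2 : k) - p.2) / (a p.1.1 - e p.1.1) * a p.1.1),
       ((p.1.2 : k) - p.2) / (a p.1.1 - e p.1.1)))).
  - by regularity.
  - have ae0 (z : subspace T) : a (val z).1.1 - e (val z).1.1 != 0.
      have [[/H[_ _ ae] _] _] := @set_valP _ T z.
      by rewrite subr_eq0.
    by regularity.
  - move=> [[x u] v] [/= Sx]; have [tE dE ae] := H x Sx.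
    have ae0 : a x - e x != 0 by rewrite subr_eq0.
    have -> : qnorm (t x) (d x) u v = (u + v * a x) * (u + v * e x).
      by rewrite /qnorm tE dE; ring.
    rewrite mulf_eq0 negb_or => /andP[ua ue]; split=> //.
    have -> : (u + v * a x - (u + v * e x)) / (a x - e x) = v by field.
    by rewrite addrK.
  - move=> [[x u] v] [[/= Sx u0] v0]; have [tE dE ae] := H x Sx.
    have ae0 : a x - e x != 0 by rewrite subr_eq0.
    rewrite subrK; split; last by congr (_, _); field.
    split=> //=; rewrite [qnorm _ _ _ _](_ : _ = u * v); first exact: mulf_neq0.
    by rewrite /qnorm tE dE; field.
rewrite (IHm _ (fun p : plane X => a p.1.1) (fun p => e p.1.1)); [|by regularity..| |].
- rewrite (class_iso iS) (classX (affine_setX aS affine_Gm) affine_Gm).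
  rewrite (classX aS affine_Gm) class_Gm.
  by rewrite mulnS addnC !exprD; ring.
- apply: is_affine_iso (isomorphic_sym iS) _.
  by do !apply: affine_setX => //; exact: affine_Gm.
- by move=> [[x u] v] [/= Sx _]; exact: H.
Qed.

(** With a double root [a], [x + y z] is a unit when [x + y a] is nonzero, and [y]
    is free. *)
Lemma units_class_ramified m X (a t d : X -> k) (S : set X) :
  regular a -> affine_set S ->
  (forall x, S x -> t x = a x + a x /\ d x = a x * a x) ->
  units_class m t d S = class S * (L * (L - 1)) ^+ m.
Proof.
elim: m X a t d S => [|m IHm] X a t d S ra aS H /=.
  by rewrite mulr1.
pose T : set (plane X) := (S `*` Gm) `*` setT.
have iS : isomorphic (subspace (unit_set t d S)) (subspace T).
  apply: (@isomorphic_sub _ (plane X) (plane X) (unit_set t d S) T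
    (fun p : plane X => ((p.1.1, (p.1.2 : k) + p.2 * a p.1.1), p.2))
    (fun p : plane X => ((p.1.1, (p.1.2 : k) - p.2 * a p.1.1), p.2))).
  - by regularity.
  - by regularity.
  - move=> [[x u] v] [/= Sx]; have [tE dE] := H x Sx.
    have -> : qnorm (t x) (d x) u v = (u + v * a x) ^+ 2.
      by rewrite /qnorm tE dE; ring.
    by rewrite expf_eq0 /= => ua; rewrite addrK.
  - move=> [[x u] v] [[/= Sx u0] _]; have [tE dE] := H x Sx.
    rewrite subrK; split=> //; split=> //=.
    rewrite [qnorm _ _ _ _](_ : _ = u ^+ 2); first exact: expf_neq0.
    by rewrite /qnorm tE dE; ring.
rewrite (IHm _ (fun p : plane X => a p.1.1)); [|by regularity| |].
- rewrite (class_iso iS) (classX (affine_setX aS affine_Gm) affine_line).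
  rewrite (classX aS affine_Gm) class_Gm.
  by rewrite exprS; ring.
- apply: is_affine_iso (isomorphic_sym iS) _.
  apply: affine_setX; last exact: affine_line.
  by apply: affine_setX => //; exact: affine_Gm.
- by move=> [[x u] v] [/= Sx _]; exact: H.
Qed.

End Units.

Arguments Gm {k}.
Arguments affine_line {k}.
Arguments affine_Gm {k}.

(** * Commutants of 2 x 2 matrices *)

Section Matrices.
Variable F : fieldType.
Implicit Types A B : 'M[F]_2.

Lemma mx2P A B : A 0 0 = B 0 0 -> A 0 1 = B 0 1 -> A 1 0 = B 1 0 ->
  A 1 1 = B 1 1 -> A = B.
Proof.
have I2 (i : 'I_2) : i = 0 \/ i = 1.
  by case: i => [[|[|//]] h]; [left|right]; exact: val_inj.
by move=> ? ? ? ?; apply/matrixP => i j; case: (I2 i) => ->; case: (I2 j) => ->.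
Qed.

Lemma mulmx2 A B i j : (A *m B) i j = A i 0 * B 0 j + A i 1 * B 1 j.
Proof.
rewrite mxE !big_ord_recl big_ord0 addr0.
by congr (_ * _ + A i _ * B _ j); exact: val_inj.
Qed.

Lemma det2 A : \det A = A 0 0 * A 1 1 - A 0 1 * A 1 0.
Proof.
rewrite (expand_det_row A 0) !big_ord_recl big_ord0 addr0 /cofactor !det_mx11 !mxE /=.
have -> : lift 0 (0 : 'I_1) = 1 :> 'I_2 by exact: val_inj.
have -> : lift 1 (0 : 'I_1) = 0 :> 'I_2 by exact: val_inj.
by rewrite expr0 expr1 mul1r mulN1r mulrN.
Qed.

Lemma tr2 A : \tr A = A 0 0 + A 1 1.
Proof.
rewrite /mxtrace !big_ord_recl big_ord0 addr0; congr (_ + A _ _); exact: val_inj.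
Qed.

Definition pencil A (x y : F) : 'M[F]_2 := x%:M + y *: A.

Lemma pencilE A x y i j : pencil A x y i j = x *+ (i == j) + y * A i j.
Proof. by rewrite !mxE. Qed.

Lemma pencil_comm A x y x' y' :
  pencil A x y *m pencil A x' y' = pencil A x' y' *m pencil A x y.
Proof. by apply: mx2P; rewrite !mulmx2 !pencilE /=; ring. Qed.

Lemma pencil01 A : pencil A 0 1 = A.
Proof. by apply: mx2P; rewrite pencilE /= ?mulr0n ?mulr1n; ring. Qed.

Lemma nonscalar_entries A :
  [|| A 0 1 != 0, A 1 0 != 0 | A 0 0 != A 1 1] = (A != (A 0 0)%:M).
Proof.
apply/idP/idP.
  move=> nA; apply/eqP => AE; move: nA; rewrite AE !mxE /=.
  by rewrite !eqxx.
apply: contraR; rewrite !negb_or !negbK => /and3P[/eqP b0 /eqP c0 /eqP ae].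
by apply/eqP; apply: mx2P; rewrite !mxE /= ?mulr1n ?mulr0n.
Qed.

(** The entries 01, 10 and the difference of the diagonal entries are the
    coordinates of a matrix modulo the scalars. Commuting means that the
    coordinate vectors of [A] and [B] are parallel; since that of [A] is nonzero,
    that of [B] is a multiple of it. *)
Lemma nonscalar_commute A B : A != (A 0 0)%:M ->
  A *m B = B *m A -> exists x y, B = pencil A x y.
Proof.
rewrite -nonscalar_entries => nA cAB.
have e00 : A 0 1 * B 1 0 = A 1 0 * B 0 1.
  have /matrixP/(_ 0 0) := cAB; rewrite !mulmx2 => E.
  by apply/eqP; rewrite -subr_eq0; apply/eqP; move/eqP: E; rewrite -subr_eq0 => /eqP <-; ring.
have e01 : (A 0 0 - A 1 1) * B 0 1 = A 0 1 * (B 0 0 - B 1 1).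
  have /matrixP/(_ 0 1) := cAB; rewrite !mulmx2 => E.
  by apply/eqP; rewrite -subr_eq0; apply/eqP; move/eqP: E; rewrite -subr_eq0 => /eqP <-; ring.
have e10 : (A 0 0 - A 1 1) * B 1 0 = A 1 0 * (B 0 0 - B 1 1).
  have /matrixP/(_ 1 0) := cAB; rewrite !mulmx2 => E.
  apply/eqP; rewrite -subr_eq0; apply/eqP; move/eqP: E; rewrite -subr_eq0 => /eqP E.
  by rewrite -[RHS]oppr0 -E; ring.
suff [y [h01 h10 hd]] : exists y, [/\ B 0 1 = y * A 0 1, B 1 0 = y * A 1 0 &
    B 0 0 - B 1 1 = y * (A 0 0 - A 1 1)].
  exists (B 0 0 - y * A 0 0), y; apply: mx2P; rewrite pencilE /= ?mulr0n ?mulr1n ?add0r //.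
    by rewrite subrK.
  by rewrite -[LHS](subKr (B 0 0)) hd; ring.
case/or3P: nA => [b0|c0|]; last rewrite -subr_eq0 => d0.
- exists (B 0 1 / A 0 1); split; first by rewrite divfK.
    by apply: (mulfI b0); rewrite e00; field.
  by apply: (mulfI b0); rewrite -e01; field.
- exists (B 1 0 / A 1 0); split; last by apply: (mulfI c0); rewrite -e10; field.
    by apply: (mulfI c0); rewrite -e00; field.
  by rewrite divfK.
- exists ((B 0 0 - B 1 1) / (A 0 0 - A 1 1)); split; last by rewrite divfK.
    by apply: (mulfI d0); rewrite e01; field.
  by apply: (mulfI d0); rewrite e10; field.
Qed.

(** The condition on [l] says that it is invariant under the addition of scalars,
    and homogeneous: [l] detects matrices that are not scalar. *)
Lemma nonscalar_functional (l : 'M[F]_2 -> F) A :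
  (forall B x y, l (pencil B x y) = y * l B) -> l A != 0 ->
  A != (A 0 0)%:M.
Proof.
move=> lE; apply: contra => /eqP AE.
have : l (pencil A (A 0 0) 0) = l A.
  by congr l; rewrite {3}AE /pencil scale0r addr0.
by rewrite lE mul0r => <-.
Qed.

End Matrices.

Lemma det_pencil (k : closedFieldType) (A : 'M[k]_2) x y :
  \det (pencil A x y) = qnorm (\tr A) (\det A) x y.
Proof. by rewrite !det2 !pencilE tr2 /qnorm /= ?mulr0n ?mulr1n; ring. Qed.

Section Tuples.
Variable k : closedFieldType.
Implicit Types X Y Z : space k.

Local Notation M2 := (affine_space ('M[k]_2 : vectType k)).
Local Notation tuples m := (affine_space (matrix_tuples k m)).

Definition cons_tuple m (A : 'M[k]_2) (B : {ffun 'I_m -> 'M[k]_2}) :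
    {ffun 'I_m.+1 -> 'M[k]_2} :=
  [ffun i => if unlift ord0 i is Some j then B j else A].

Definition behead_tuple m (A : {ffun 'I_m.+1 -> 'M[k]_2}) :
    {ffun 'I_m -> 'M[k]_2} := [ffun j => A (lift ord0 j)].

Lemma cons_tuple0 m A (B : {ffun 'I_m -> 'M[k]_2}) : cons_tuple A B ord0 = A.
Proof. by rewrite ffunE unlift_none. Qed.

Lemma cons_tuple_lift m A (B : {ffun 'I_m -> 'M[k]_2}) j :
  cons_tuple A B (lift ord0 j) = B j.
Proof. by rewrite ffunE liftK. Qed.

Lemma cons_tupleK m A (B : {ffun 'I_m -> 'M[k]_2}) :
  behead_tuple (cons_tuple A B) = B.
Proof. by apply/ffunP => j; rewrite ffunE cons_tuple_lift. Qed.

Lemma behead_tupleK m (A : {ffun 'I_m.+1 -> 'M[k]_2}) :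
  cons_tuple (A ord0) (behead_tuple A) = A.
Proof. by apply/ffunP => i; rewrite !ffunE; case: unliftP => [j ->|->]; rewrite ?ffunE. Qed.

Lemma forall_ordS m (P : 'I_m.+1 -> Prop) :
  (forall i, P i) <-> P ord0 /\ forall j, P (lift ord0 j).
Proof.
split=> [h|[h0 h] i]; first by split.
by case: (unliftP ord0 i) => [j ->|->].
Qed.

Lemma morphism_cons Z m (f : Z -> M2) (g : Z -> tuples m) :
  morphism f -> morphism g ->
  morphism ((fun z => cons_tuple (f z) (g z)) : Z -> tuples m.+1).
Proof.
move=> mf mg; apply: morphism_tuples => i a b.
have -> : (fun z => cons_tuple (f z) (g z) i a b) =
    (if unlift ord0 i is Some j then fun z => (g z : {ffun _ -> 'M[k]_2}) j a b
     else fun z => (f z : 'M[k]_2) a b).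
  by apply/funext => z; rewrite ffunE; case: unlift.
by case: unlift => [j|]; [exact: regular_tuples|exact: regular_mx].
Qed.

Lemma morphism_behead Z m (f : Z -> tuples m.+1) :
  morphism f -> morphism ((fun z => behead_tuple (f z)) : Z -> tuples m).
Proof.
move=> mf; apply: morphism_tuples => j a b.
rewrite (_ : (fun z => _) = fun z => (f z : {ffun _ -> 'M[k]_2}) (lift ord0 j) a b).
  exact: regular_tuples.
by apply/funext => z; rewrite ffunE.
Qed.

Lemma morphism_pencil Z (f : Z -> 'M[k]_2) (x y : Z -> k) :
  morphism (f : Z -> M2) -> regular x -> regular y ->
  morphism ((fun z => pencil (f z) (x z) (y z)) : Z -> M2).
Proof.
move=> mf rx ry; apply: morphism_mx => i j.
rewrite (_ : (fun z => _) = fun z => x z * (i == j)%:R + y z * f z i j).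
  by regularity.
by apply/funext => z; rewrite pencilE mulr_natr.
Qed.

(** Where [A] is not scalar, its centralizer is commutative, so that these are the
    tuples of invertible matrices that commute with [A] and with each other. *)
Definition centralizing m X (A : X -> 'M[k]_2) (S : set X) :
    set (product X (tuples m)) :=
  [set p | S p.1 /\ forall j : 'I_m, (p.2 : {ffun _ -> 'M[k]_2}) j \in unitmx /\
     A p.1 *m (p.2 : {ffun _ -> 'M[k]_2}) j =
     (p.2 : {ffun _ -> 'M[k]_2}) j *m A p.1].

(** A matrix [B] in the centralizer of [A x] is [x0 + y0 A x]. A single functional
    [l] that vanishes nowhere on [A] makes [y0 = l B / l (A x)], and then [x0],
    regular functions on the whole of [S]. *)
Lemma centralizing_class m X (A : X -> 'M[k]_2) (S : set X) (l : 'M[k]_2 -> k) :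
  morphism (A : X -> M2) -> regular (l : M2 -> k) ->
  (forall B x y, l (pencil B x y) = y * l B) ->
  (forall x, S x -> l (A x) != 0) ->
  class (@centralizing m X A S) =
    units_class m (fun x => \tr (A x)) (fun x => \det (A x)) S.
Proof.
move=> mA rl lE lA.
elim: m X A S mA lA => [|m IHm] X A S mA lA /=.
  apply: class_iso.
  apply: (@isomorphic_sub _ (product X (tuples 0)) X _ S fst
    (fun x => (x, 0 : {ffun 'I_0 -> 'M[k]_2}))).
  - by regularity.
  - apply: morphism_pair; first by regularity.
    by apply: morphism_tuples => -[].
  - move=> [x B] [/= Sx _]; split=> //; congr pair.
    by apply/ffunP => -[].
  - by move=> x Sx; split=> //; split=> // -[].
have nA x : S x -> A x != (A x 0 0)%:M.
  by move=> /lA; exact: nonscalar_functional lE.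
rewrite -(IHm (plane X) (fun p => A p.1.1)); last 2 first.
- by regularity.
- by move=> p [/lA].
apply: class_iso.
pose f (p : product X (tuples m.+1)) : product (plane X) (tuples m) :=
  let: B0 := (p.2 : {ffun _ -> 'M[k]_2}) ord0 in
  (((p.1, B0 0 0 - l B0 / l (A p.1) * A p.1 0 0), l B0 / l (A p.1)),
   behead_tuple p.2).
pose g (r : product (plane X) (tuples m)) : product X (tuples m.+1) :=
  (r.1.1.1, cons_tuple (pencil (A r.1.1.1) r.1.1.2 r.1.2) r.2).
apply: (@isomorphic_sub _ _ _ _ _ f g).
- have lA0 (p : subspace (@centralizing m.+1 X A S)) : l (A (val p).1) != 0.
    by have [/lA] := @set_valP _ (@centralizing m.+1 X A S) p.
  apply: morphism_pair; last by apply: morphism_behead; regularity.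
  by regularity.
- apply: morphism_pair; first by regularity.
  by apply: morphism_cons; [apply: morphism_pencil|]; regularity.
- move=> [x B] [/= Sx cB]; have [[uB0 cB0] {}cB] := (forall_ordS _).1 cB.
  have [x0 [y0 B0E]] := nonscalar_commute (nA x Sx) cB0.
  have yE : l (B ord0) / l (A x) = y0 by rewrite B0E lE mulfK ?lA.
  have xE : B ord0 0 0 - y0 * A x 0 0 = x0.
    by rewrite B0E pencilE mulr1n addrK.
  rewrite /f /g /= yE xE -B0E behead_tupleK; split=> //; split.
    split=> //=; rewrite -det_pencil -B0E.
    by move: uB0; rewrite unitmxE unitfE.
  by move=> j; rewrite ffunE; exact: cB.
- move=> [[[x x0] y0] B] [[/= Sx N0] cB]; split.
    split=> //=; apply/forall_ordS; rewrite cons_tuple0; split; last first.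
      by move=> j; rewrite cons_tuple_lift; exact: cB.
    rewrite unitmxE unitfE det_pencil; split=> //.
    by rewrite -{1 4}(pencil01 (A x)) pencil_comm.
  rewrite /f /g /= cons_tuple0 cons_tupleK lE mulfK ?lA // pencilE mulr1n.
  by rewrite addrK.
Qed.

End Tuples.

(** * The stratification by the first matrix *)

Section Strata.
Variable k : closedFieldType.
Implicit Types X Y Z : space k.

Local Notation L := (class [set: line k]).
Local Notation M2 := (affine_space ('M[k]_2 : vectType k)).
Local Notation tuples m := (affine_space (matrix_tuples k m)).

Lemma class_line : virtual_class (affine_variety 'rV[k]_1) = L.
Proof.
apply: classE; first exact: affine_line.
apply: isomorphic_trans (isomorphic_sym (isomorphic_setT _)).
exists ((fun v => (v : 'rV[k]_1) 0 0) : affine_space 'rV[k]_1 -> line k).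
exists ((fun c => const_mx (c : k)) : line k -> affine_space 'rV[k]_1); split.
- apply: morphism_line; apply: regular_mx; exact: morphism_id.
- apply: morphism_mx => i j; rewrite (_ : (fun z => _) = id); first by regularity.
  by apply/funext => c; rewrite mxE.
- by move=> v; apply/rowP => i; rewrite mxE ord1.
- by move=> c; rewrite mxE.
Qed.

Definition mat2 (a b c d : k) : 'M[k]_2 := \matrix_(i < 2, j < 2)
  if i == 0 then if j == 0 then a else b else if j == 0 then c else d.

Lemma morphism_mat2 Z (a b c d : Z -> k) :
  regular a -> regular b -> regular c -> regular d ->
  morphism ((fun z => mat2 (a z) (b z) (c z) (d z)) : Z -> M2).
Proof.
move=> ra rb rc rd; apply: morphism_mx => i j.
rewrite (_ : (fun z => _) =
  if i == 0 then if j == 0 then a else b else if j == 0 then c else d).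
  by case: (i == 0); case: (j == 0).
by apply/funext => z; rewrite mxE; case: (i == 0); case: (j == 0).
Qed.

(** The condition [A i] commutes with [A j] for all i and j amounts to that with
    [A ord0] only: when the latter is not scalar, all the matrices that commute
    with it lie in one pencil. *)
Lemma commuting_stratum m (P : set M2) (l : 'M[k]_2 -> k) :
  regular (l : M2 -> k) -> (forall B x y, l (pencil B x y) = y * l B) ->
  (forall A, P A -> l A != 0) ->
  class (@commuting_GL2 k m.+1 `&`
    [set A | P ((A : {ffun 'I_m.+1 -> 'M[k]_2}) ord0)]) =
  units_class m (fun A : M2 => \tr (A : 'M[k]_2)) (fun A : M2 => \det (A : 'M[k]_2))
    [set A | (A : 'M[k]_2) \in unitmx /\ P A].
Proof.
move=> rl lE lP; set S := [set A | _ /\ _].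
rewrite -(@centralizing_class k m M2 id S l (@morphism_id k M2) rl lE); last by move=> A [_ /lP].
apply: class_iso.
apply: (@isomorphic_sub _ (tuples m.+1) (product M2 (tuples m)) _
  (@centralizing k m M2 id S)
  (fun A => ((A : {ffun 'I_m.+1 -> 'M[k]_2}) ord0, behead_tuple A))
  (fun p => cons_tuple p.1 p.2)).
- apply: morphism_pair; first by regularity.
  by apply: morphism_behead; regularity.
- by apply: morphism_cons; regularity.
- move=> A [/= [uA cA] P0]; split; last exact: behead_tupleK.
  by split=> //= j; rewrite ffunE.
- move=> [A B] [/= [uA PA] cB]; rewrite cons_tuple0 cons_tupleK; split=> //.
  split=> //.
  have nA : A != (A 0 0)%:M by exact: nonscalar_functional lE (lP _ PA).
  have pB i : exists x y, cons_tuple A B i = pencil A x y.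
    move: i; apply/forall_ordS; rewrite cons_tuple0; split.
      by exists 0, 1; rewrite pencil01.
    move=> j; rewrite cons_tuple_lift.
    by apply: nonscalar_commute => //; have [] := cB j.
  split.
    apply/forall_ordS; rewrite cons_tuple0; split=> // j.
    by rewrite cons_tuple_lift; have [] := cB j.
  move=> i j; have [x [y ->]] := pB i; have [x' [y' ->]] := pB j.
  exact: pencil_comm.
Qed.

Lemma commuting_scalar_stratum m :
  class (@commuting_GL2 k m.+1 `&`
    [set A | let A0 := (A : {ffun 'I_m.+1 -> 'M[k]_2}) ord0 in A0 = (A0 0 0)%:M]) =
  (L - 1) * class (@commuting_GL2 k m).
Proof.
rewrite -class_Gm -classX; [|exact: affine_Gm|exact: commuting_GL2_affine].
apply: class_iso.
apply: (@isomorphic_sub _ (tuples m.+1) (product (line k) (tuples m)) _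
  (Gm `*` @commuting_GL2 k m)
  (fun A => ((A : {ffun 'I_m.+1 -> 'M[k]_2}) ord0 0 0, behead_tuple A))
  (fun p => cons_tuple (pencil 0 p.1 0) p.2)).
- apply: morphism_pair; first by regularity.
  by apply: morphism_behead; regularity.
- apply: morphism_cons; last by regularity.
  have m0 Z : morphism ((fun _ => 0) : Z -> M2).
    by apply: morphism_mx => i j; regularity.
  by apply: (morphism_pencil (m0 _)); regularity.
- move=> A [/= [uA cA] A0]; rewrite /pencil scale0r addr0 -A0 behead_tupleK; split=> //.
  split=> /=; last by split=> [j|i j]; rewrite !ffunE.
  apply/eqP => a0; have := uA ord0; rewrite a0 in A0.
  by rewrite A0 unitmxE det_scalar expr0n unitr0.
- move=> [a B] [/= a0 [uB cB]]; rewrite /pencil scale0r addr0.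
  split; last by rewrite cons_tuple0 cons_tupleK mxE eqxx mulr1n.
  split; last by rewrite /= cons_tuple0 mxE eqxx mulr1n.
  split.
    apply/forall_ordS; rewrite cons_tuple0; split.
      by rewrite unitmxE det_scalar unitfE expf_neq0.
    by move=> j; rewrite cons_tuple_lift.
  apply/forall_ordS; rewrite cons_tuple0; split=> [i|i].
    by rewrite scalar_mxC.
  rewrite cons_tuple_lift; apply/forall_ordS; rewrite cons_tuple0; split=> [|j].
    by rewrite scalar_mxC.
  by rewrite cons_tuple_lift.
Qed.

Local Notation line2 := (product (line k) (line k)).

(** The pairs (t, d) of the trace and the determinant of an invertible matrix. *)
Definition charpolys : set line2 := setT `*` Gm.
Definition eigenpairs : set line2 := Gm `*` Gm.

Definition charpolys_class m : K0 k :=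
  units_class m (fun p : line2 => p.1 : k) (fun p : line2 => p.2 : k) charpolys.
Definition eigenpairs_class m : K0 k :=
  units_class m (fun p : line2 => (p.1 : k) + p.2)
    (fun p : line2 => (p.1 : k) * p.2) eigenpairs.
Definition distinct_class m : K0 k :=
  units_class m (fun p : line2 => (p.1 : k) + p.2)
    (fun p : line2 => (p.1 : k) * p.2)
    (eigenpairs `&` [set p : line2 | (p.1 : k) - p.2 != 0]).

Let r1 : regular (fun p : line2 => p.1 : k). Proof. by regularity. Qed.
Let r2 : regular (fun p : line2 => p.2 : k). Proof. by regularity. Qed.
Let rB : regular (fun p : line2 => (p.1 : k) - p.2). Proof. by regularity. Qed.
Let rt : regular (fun p : line2 => (p.1 : k) + p.2). Proof. by regularity. Qed.
Let rd : regular (fun p : line2 => (p.1 : k) * p.2). Proof. by regularity. Qed.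

Lemma affine_charpolys : affine_set charpolys.
Proof. by apply: affine_setX; [exact: affine_line|exact: affine_Gm]. Qed.

Lemma affine_eigenpairs : affine_set eigenpairs.
Proof. by apply: affine_setX; exact: affine_Gm. Qed.

Lemma charpolys_class0 : charpolys_class 0 = L * (L - 1).
Proof.
by rewrite /charpolys_class /= (classX affine_line affine_Gm) class_Gm.
Qed.

(** A pair (t, d) with a root [r] of z^2 - t z + d is the ordered pair of roots
    [(r, t - r)]. *)
Lemma charpolys_classS m :
  charpolys_class m.+1 =
    (L ^+ 2 - 1) * charpolys_class m - (L - 1) * eigenpairs_class m.
Proof.
rewrite [LHS](units_class_rec m r1 r2 affine_charpolys).
congr (_ - _ * _); apply: units_class_iso.
exists (fun p : product line2 (line k) => (p.2, (p.1.1 : k) - p.2)).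
exists (fun p : line2 => (((p.1 : k) + p.2, (p.1 : k) * p.2), p.1)).
split; try by regularity.
- move=> [[t d] r] [[/= _ d0] E]; rewrite /Gm /= in d0.
  have dE : d = r * (t - r).
    by apply/eqP; rewrite -subr_eq0 -E; apply/eqP; ring.
  have tE : r + (t - r) = t by ring.
  rewrite /= tE -dE; split=> //.
  by move: d0; rewrite dE mulf_eq0 negb_or => /andP[].
- move=> [a e] [/= a0 e0]; rewrite /Gm /= in a0 e0; split.
    split; first by split=> //; rewrite /Gm /= mulf_neq0.
    by rewrite /=; ring.
  by rewrite [a + e]addrC addrK.
Qed.

Let diagonal := eigenpairs `&` [set p : line2 | (p.1 : k) - p.2 = 0].

Let class_diagonal : class diagonal = L - 1.
Proof.
rewrite -class_Gm; apply: class_iso.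
apply: (@isomorphic_sub _ line2 (line k) diagonal Gm fst (fun x => (x, x))).
- by regularity.
- by regularity.
- move=> [a e] [[/= a0 e0] /eqP]; rewrite subr_eq0 => /eqP ae.
  by split=> //; congr pair.
- by move=> a a0; split=> //; split=> //=; rewrite subrr.
Qed.

Lemma distinct_classE m :
  distinct_class m = ((L - 1) ^+ 2 - (L - 1)) * (L - 1) ^+ (2 * m).
Proof.
rewrite /distinct_class (units_class_split m r1 r2).
- congr (_ * _); have := class_scissor affine_eigenpairs rB.
  rewrite -/diagonal class_diagonal (classX affine_Gm affine_Gm) class_Gm => E.
  by rewrite expr2 E addrK.
- exact: affine_set_neq0 affine_eigenpairs rB.
- by move=> p [_ /=]; rewrite subr_eq0.
Qed.

Lemma eigenpairs_classE m :
  eigenpairs_class m = distinct_class m + (L - 1) * (L * (L - 1)) ^+ m.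
Proof.
rewrite [LHS](units_class_scissor m rt rd affine_eigenpairs rB); congr (_ + _).
rewrite -/diagonal (units_class_ramified m r1) ?class_diagonal //.
- exact: affine_set_eq0 affine_eigenpairs rB.
- by move=> p [_ /eqP]; rewrite subr_eq0 => /eqP <-.
Qed.

(** When the entry 01 is nonzero, it, the entry 00, the trace and the determinant
    are free coordinates of the matrix. *)
Lemma upper_stratum m :
  units_class m (fun A : M2 => \tr (A : 'M[k]_2)) (fun A : M2 => \det (A : 'M[k]_2))
    [set A | (A : 'M[k]_2) \in unitmx /\ (A : 'M[k]_2) 0 1 != 0] =
  L * (L - 1) * charpolys_class m.
Proof.
have r1' : regular (fun p : product line2 (line k) => p.1.1 : k) by regularity.
have r2' : regular (fun p : product line2 (line k) => p.1.2 : k) by regularity.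
have aS := affine_setX affine_charpolys affine_line.
rewrite mulrC mulrA -[L - 1]class_Gm.
rewrite -(units_classX m r1 r2 affine_charpolys affine_line).
rewrite -(units_classX m r1' r2' aS affine_Gm).
apply: units_class_iso.
exists (fun A : M2 => ((((A : 'M[k]_2) 0 0 + (A : 'M[k]_2) 1 1,
  (A : 'M[k]_2) 0 0 * (A : 'M[k]_2) 1 1 - (A : 'M[k]_2) 0 1 * (A : 'M[k]_2) 1 0),
  (A : 'M[k]_2) 0 0), (A : 'M[k]_2) 0 1)).
exists (fun p : plane line2 => mat2 p.1.2 p.2
  (((p.1.2 : k) * ((p.1.1.1 : k) - p.1.2) - p.1.1.2) / p.2) ((p.1.1.1 : k) - p.1.2)).
pose T : set (plane line2) := (charpolys `*` setT) `*` Gm.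
split.
- by regularity.
- have p0 (p : subspace T) : ((val p).2 : k) != 0.
    by have [_] := @set_valP _ T p.
  by apply: morphism_mat2; regularity.
- move=> A [/=]; rewrite unitmxE unitfE det2 => uA b0; split=> //=.
  + by rewrite [_ + A 1 1]addrC addrK; apply: mx2P; rewrite mxE //=; field.
  + by rewrite tr2.
- move=> [[[t d] a] b] [[[/= _ d0] _] b0]; rewrite /Gm /= in d0 b0.
  have E : a * (t - a) - b * ((a * (t - a) - d) / b) = d by field.
  by rewrite unitmxE unitfE det2 !mxE /= E [a + _]addrC subrK.
Qed.

(** A lower triangular matrix has its eigenvalues on the diagonal. *)
Lemma lower_stratum m :
  units_class m (fun A : M2 => \tr (A : 'M[k]_2)) (fun A : M2 => \det (A : 'M[k]_2))
    [set A | (A : 'M[k]_2) \in unitmx /\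
       ((A : 'M[k]_2) 0 1 = 0 /\ (A : 'M[k]_2) 1 0 != 0)] =
  (L - 1) * eigenpairs_class m.
Proof.
rewrite mulrC -class_Gm -(units_classX m rt rd affine_eigenpairs affine_Gm).
apply: units_class_iso.
exists (fun A : M2 => (((A : 'M[k]_2) 0 0, (A : 'M[k]_2) 1 1), (A : 'M[k]_2) 1 0)).
exists (fun p : product line2 (line k) => mat2 p.1.1 0 p.2 p.1.2).
split; first by regularity.
- by apply: morphism_mat2; regularity.
- move=> A [/=]; rewrite unitmxE unitfE det2 => + [b0 c0].
  rewrite b0 mul0r subr0 mulf_eq0 negb_or => /andP[a0 e0]; split=> //=.
  + by apply: mx2P; rewrite mxE.
  + by rewrite tr2.
- move=> [[a e] c] [[/= a0 e0] c0]; rewrite unitmxE unitfE det2 !mxE /=.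
  by rewrite mul0r subr0 mulf_neq0.
Qed.

Lemma diagonal_stratum m :
  units_class m (fun A : M2 => \tr (A : 'M[k]_2)) (fun A : M2 => \det (A : 'M[k]_2))
    [set A | (A : 'M[k]_2) \in unitmx /\
       [/\ (A : 'M[k]_2) 0 1 = 0, (A : 'M[k]_2) 1 0 = 0 &
           (A : 'M[k]_2) 0 0 - (A : 'M[k]_2) 1 1 != 0]] =
  distinct_class m.
Proof.
apply: units_class_iso.
exists (fun A : M2 => ((A : 'M[k]_2) 0 0, (A : 'M[k]_2) 1 1)).
exists (fun p : line2 => mat2 p.1 0 0 p.2).
split; first by regularity.
- by apply: morphism_mat2; regularity.
- move=> A [/=]; rewrite unitmxE unitfE det2 => + [b0 c0 ae].
  rewrite b0 mul0r subr0 mulf_eq0 negb_or => /andP[a0 e0]; split=> //=.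
  + by apply: mx2P; rewrite mxE.
  + by rewrite tr2.
- move=> [a e] [[/= a0 e0] ae]; rewrite unitmxE unitfE det2 !mxE /=.
  by rewrite mul0r subr0 mulf_neq0.
Qed.

Lemma commuting_class0 : class (@commuting_GL2 k 0) = 1.
Proof.
rewrite -(@class_pt _ (tuples 0) (0 : {ffun 'I_0 -> 'M[k]_2})); congr class.
apply/seteqP; split=> [A _|_ ->]; first by apply/ffunP => -[].
by split=> -[].
Qed.

Lemma commuting_classS m :
  class (@commuting_GL2 k m.+1) =
    (L - 1) * class (@commuting_GL2 k m) + L * (L - 1) * charpolys_class m +
    (L - 1) * eigenpairs_class m + distinct_class m.
Proof.
set G := @commuting_GL2 k m.+1.
have aG : affine_set G by exact: commuting_GL2_affine.
pose e i j (A : tuples m.+1) : k := (A : {ffun 'I_m.+1 -> 'M[k]_2}) ord0 i j.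
have re i j : regular (e i j) by rewrite /e; regularity.
have rD : regular (fun A => e 0 0 A - e 1 1 A) by regularity.
have aG1 := affine_set_eq0 aG (re 0 1).
have aG2 := affine_set_eq0 aG1 (re 1 0).
have re' (i j : 'I_2) : regular (fun A : M2 => (A : 'M[k]_2) i j) by regularity.
have rD' : regular (fun A : M2 => (A : 'M[k]_2) 0 0 - (A : 'M[k]_2) 1 1) by regularity.
rewrite (class_scissor aG (re 0 1)) (class_scissor aG1 (re 1 0)).
rewrite (class_scissor aG2 rD).
rewrite -commuting_scalar_stratum -upper_stratum -lower_stratum -diagonal_stratum.
rewrite -(@commuting_stratum m [set A | (A : 'M[k]_2) 0 1 != 0] (fun A => A 0 1)) //;
  last by move=> B x y; rewrite pencilE mulr0n add0r.
rewrite -(@commuting_stratum m [set A | (A : 'M[k]_2) 0 1 = 0 /\ (A : 'M[k]_2) 1 0 != 0]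
    (fun A => A 1 0)) //; last 2 first.
- by move=> B x y; rewrite pencilE mulr0n add0r.
- by move=> A [].
rewrite -(@commuting_stratum m [set A | [/\ (A : 'M[k]_2) 0 1 = 0,
    (A : 'M[k]_2) 1 0 = 0 & (A : 'M[k]_2) 0 0 - (A : 'M[k]_2) 1 1 != 0]]
    (fun A => A 0 0 - A 1 1)) //; last 2 first.
- by move=> B x y; rewrite !pencilE !mulr1n /=; ring.
- by move=> A [].
rewrite -/G.
have -> : G `&` [set A | let A0 := (A : {ffun 'I_m.+1 -> 'M[k]_2}) ord0 in
     A0 = (A0 0 0)%:M] = G `&` [set A | e 0 1 A = 0] `&` [set A | e 1 0 A = 0] `&`
     [set A | e 0 0 A - e 1 1 A = 0].
  apply/seteqP; split=> [A [GA /= A0]|A [[[GA b0] c0] /eqP]].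
    by do !split=> //; rewrite /= /e A0 !mxE //= subrr.
  rewrite subr_eq0 => /eqP ae; split=> //=.
  by apply: mx2P; rewrite !mxE /= ?mulr1n ?mulr0n //; exact/esym.
have -> : G `&` [set A | e 0 1 A = 0] `&` [set A | e 1 0 A != 0] =
    G `&` [set A | [set A | (A : 'M[k]_2) 0 1 = 0 /\ (A : 'M[k]_2) 1 0 != 0]
      ((A : {ffun 'I_m.+1 -> 'M[k]_2}) ord0)].
  by apply/seteqP; split=> [A [[]]|A [? []]].
have -> : G `&` [set A | e 0 1 A = 0] `&` [set A | e 1 0 A = 0] `&`
     [set A | e 0 0 A - e 1 1 A != 0] =
    G `&` [set A | [set A | [/\ (A : 'M[k]_2) 0 1 = 0, (A : 'M[k]_2) 1 0 = 0 &
        (A : 'M[k]_2) 0 0 - (A : 'M[k]_2) 1 1 != 0]]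
      ((A : {ffun 'I_m.+1 -> 'M[k]_2}) ord0)].
  by apply/seteqP; split=> [A [[[]]]|A [? []]].
by rewrite /=; ring.
Qed.

End Strata.

(** * Solution of the recursions *)

Section ClosedForm.
Variables (R : comPzRingType) (q : R).

(** The part of the class of (k^x x k^x)^m on which the swap of the two factors k^x
    acts by -1: one factor k^x x k^x has invariant part q (q - 1) and odd part
    1 - q. *)
Fixpoint torus_odd (m : nat) : R :=
  if m is m'.+1 then
    (1 - q) * (q - 1) ^+ (2 * m') + (q ^+ 2 - 1) * torus_odd m' else 0.

(** The components of A^(m-1) w^T: the scalar tuples, the nonscalar tuples with
    a single common eigenvector, and the even and the odd part of the tuples of
    pairs of eigenvalues that are not all scalar. *)
Definition strata (m : nat) : seq R :=
  [:: (q - 1) ^+ m;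
      (q + 1) * (q - 1) ^+ m * (q ^+ m - 1);
      (q - 1) ^+ (2 * m) - torus_odd m - (q - 1) ^+ m;
      torus_odd m].

Lemma strata_transfer (m : nat) :
  let w : 'rV[R]_4 := \row_(j < 4)
    [:: q - 1; (q - 1) * (q ^+ 2 - 1); (q - 1) ^+ 2; 1 - q]`_j in
  let v : 'rV[R]_4 := \row_(j < 4) [:: 1; 1; q ^+ 2; q]`_j in
  let A : 'M[R]_4 := \matrix_(i < 4, j < 4) (nth [::] [::
    [:: q - 1;                   0;           0;           0];
    [:: (q - 1) * (q ^+ 2 - 1);  q * (q - 1); 0;           0];
    [:: (q - 1) ^+ 2;            0;           q * (q - 1); 1 - q];
    [:: 1 - q;                   0;           1 - q;       q * (q - 1)]] i)`_j in
  (v *m A ^+ m *m w^T) 0 0 = (strata m.+1)`_0 + (strata m.+1)`_1 +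
    q ^+ 2 * (strata m.+1)`_2 + q * (strata m.+1)`_3.
Proof.
move=> w v A.
suff E : A ^+ m *m w^T = \col_(i < 4) (strata m.+1)`_i.
  by rewrite -mulmxA E mxE !big_ord_recl big_ord0 !mxE /=; ring.
elim: m => [|m IHm].
  rewrite expr0 mul1mx; apply/colP => -[[|[|[|[|//]]]] h]; rewrite !mxE //=.
  - by ring.
  - by rewrite muln1 mulr0 addr0 expr0; ring.
  - by rewrite mulr0 addr0 expr0; ring.
rewrite exprS -mulmxE -mulmxA IHm; apply/colP => -[[|[|[|[|//]]]] h];
  rewrite !mxE !big_ord_recl big_ord0 !mxE /= !mulnS !exprD !exprS; ring.
Qed.

(** The classes of [commuting_GL2], [charpolys_class], [eigenpairs_class] and
    [distinct_class], known only through their recursions. *)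
Variables c p e d : nat -> R.
Hypotheses (c0 : c 0 = 1) (p0 : p 0 = q * (q - 1)).
Hypothesis dE : forall m, d m = ((q - 1) ^+ 2 - (q - 1)) * (q - 1) ^+ (2 * m).
Hypothesis eE : forall m, e m = d m + (q - 1) * (q * (q - 1)) ^+ m.
Hypothesis pS : forall m, p m.+1 = (q ^+ 2 - 1) * p m - (q - 1) * e m.
Hypothesis cS : forall m, c m.+1 =
  (q - 1) * c m + q * (q - 1) * p m + (q - 1) * e m + d m.

Lemma charpolys_closed m : p m =
  (q - 1) ^+ 2 * (q - 1) ^+ (2 * m) + (q - 1) * (q * (q - 1)) ^+ m -
  q * (q - 1) * torus_odd m.
Proof.
elim: m => [|m IHm]; first by rewrite p0 /= muln0 !expr0; ring.
by rewrite pS IHm eE dE /= mulnS !exprD !exprS; ring.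
Qed.

Lemma commuting_closed m : c m =
  (strata m)`_0 + (strata m)`_1 + q ^+ 2 * (strata m)`_2 + q * (strata m)`_3.
Proof.
elim: m => [|m IHm]; first by rewrite c0 /= muln0 !expr0; ring.
by rewrite cS IHm charpolys_closed eE dE /= mulnS !exprD !exprMn !exprS; ring.
Qed.

End ClosedForm.

Theorem theorem4p9 (k : closedFieldType) (char_k : [pchar k] =i pred0)
    (n : nat) (n_ge1 : (1 <= n)%N) :
  let q : K0 k := virtual_class (affine_variety 'rV[k]_1) in
  let w : 'rV[K0 k]_4 := \row_(j < 4)
    [:: q - 1; (q - 1) * (q ^+ 2 - 1); (q - 1) ^+ 2; 1 - q]`_j in
  let v : 'rV[K0 k]_4 := \row_(j < 4) [:: 1; 1; q ^+ 2; q]`_j in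
  let A : 'M[K0 k]_4 := \matrix_(i < 4, j < 4) (nth [::] [::
    [:: q - 1;                   0;           0;           0];
    [:: (q - 1) * (q ^+ 2 - 1);  q * (q - 1); 0;           0];
    [:: (q - 1) ^+ 2;            0;           q * (q - 1); 1 - q];
    [:: 1 - q;                   0;           1 - q;       q * (q - 1)]] i)`_j in
  virtual_class (commuting_GL2_variety k n) = (v *m A ^+ (n - 1) *m w^T) 0 0.
Proof.
case: n n_ge1 => // m _; rewrite class_line => q w v A.
rewrite (classE (Y := commuting_GL2_variety k m.+1) (commuting_GL2_affine k m.+1)
  (isomorphic_refl _)) subn1 strata_transfer.
exact: (commuting_closed (commuting_class0 k) (charpolys_class0 k)
  (@distinct_classE k) (@eigenpairs_classE k) (@charpolys_classS k)
  (@commuting_classS k)).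
Qed.
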